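(* For every integer $n\ge1$, $\Phi_{4n}=(\tilde\phi_0,\dots,\tilde\phi_{4n})^T$ generates an orthogonal multiresolution analysis $\{V_p\}_{p=-\infty}^{\infty}$, where $V_0=V_0(\Phi_{4n})$ is the closed linear span in $L^2(\mathbf R)$ of $\{\tilde\phi_i(\cdot-j): i=0,\dots,4n,\ j\in\mathbf Z\}$ and $V_p=\{f(2^p\cdot):f\in V_0\}$, $p\in\mathbf Z$.
   Context: A sequence $(V_p)_{p\in\mathbf Z}$ with $V_0$ the closed $L^2(\mathbf R)$-span of the integer translates of compactly supported $L^2$ functions $\phi_0,\dots,\phi_r$ and $V_p=\{f(2^p\cdot):f\in V_0\}$ is a multiresolution analysis (MRA) generated by $\phi_0,\dots,\phi_r$ if (a) $\cdots\subset V_{-1}\subset V_0\subset V_1\subset\cdots$ and (b) $\phi_0,\dots,\phi_r$ and their integer translates form a Riesz basis of $V_0$. It is an orthogonal MRA if in addition $\phi_0,\dots,\phi_r$ and their integer translates form an orthogonal basis of $V_0$. $(a)_0=1$, $(a)_j=a(a+1)\cdots(a+j-1)$; ${}_pF_q\left({a_1,\dots,a_p\atop b_1,\dots,b_q};t\right)=\sum_{i\ge0}\frac{(a_1)_i\cdots(a_p)_i}{(b_1)_i\cdots(b_q)_i\,i!}t^i$. $p_n^{\alpha,\beta}$ is the monic Jacobi polynomial of degree $n$ (orthogonal on $[-1,1]$ for the weight $(1-x)^\alpha(1+x)^\beta$) and $p_n^\lambda=p_n^{\lambda-1/2,\lambda-1/2}$ the monic ultraspherical polynomial. For $j\ge2$,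 $\phi^0_j(t)=(1-t^2)\,p_{j-2}^{5/2}(t)$. For integers $n\ge1$, $m\ge0$, $\epsilon\in\{0,1\}$, $$f^{\epsilon}_{m,n}(t)= t^{\epsilon}\,\frac{(\frac12+\epsilon)_{n}\,\bigl(n^2+(\frac32+\epsilon)n+m+1+\epsilon\bigr)\,(-m+\frac12)_{n}}{(m+1+\epsilon)_{n+1}\,(n+1)!}\;{}_4F_3\!\left({-n,\ -n^2-(\frac32+\epsilon)n-m-\epsilon,\ -m-\frac12,\ n+\frac32+\epsilon \atop \frac12+\epsilon,\ -n^2-(\frac32+\epsilon)n-m-1-\epsilon,\ -m+\frac12};\,t^2\right).$$ Fix $n\ge1$. For $t\in[-1,1]$ set $$w_{4n,2n}(t)=-|t|\,t^{2n-1}+f^1_{n-1,2n-1}(t),$$ $$q_{r_0^{4n}}(t)=\frac{2(8n+1)!!}{(4n+2)!}(1+t)\,p^{1,2}_{4n-1}(t)-\frac{(-1)^n2^{4n}\,n!\,(3n)!}{(2n+1)!\,(2n)!}\,w_{4n,2n}(t),\qquad q_{l_0^{4n}}(t)=q_{r_0^{4n}}(-t).$$ (Equivalently, $q_{r_0^{4n}}$ is $r_0^{4n}=(I-P^{4n})(1+t)$ minus its orthogonal projection onto the span of $w_{4n,2n}$, where $P^{N}$ is the orthogonal projection of $L^2[-1,1]$ onto polynomials of degree $\le N$ vanishing at $\pm1$.) Define on $\mathbf R$: - $\tilde\phi_0(t)=q_{r_0^{4n}}(2t+1)$ for $-1\le t<0$, $\tilde\phi_0(t)=q_{l_0^{4n}}(2t-1)$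 for $0\le t<1$, and $0$ elsewhere; - $\tilde\phi_1(t)=w_{4n,2n}(2t-1)$ for $0\le t<1$, and $0$ elsewhere; - for $j=2,\dots,4n$: $\tilde\phi_j(t)=\phi^0_j(2t-1)$ for $0\le t<1$, and $0$ elsewhere. *)

(* Defs.v *)
From HB Require Import structures.
From mathcomp Require Import all_boot all_order all_algebra.
From mathcomp Require Import all_classical all_reals all_analysis.

Set Implicit Arguments.
Unset Strict Implicit.
Unset Printing Implicit Defensive.

Import Order.TTheory GRing.Theory Num.Theory.
Import numFieldNormedType.Exports.

Local Open Scope classical_set_scope.
Local Open Scope ring_scope.

Section L2.
Context {R : realType}.
Local Notation mu := (@lebesgue_measure R).

(* The real space L^2(R), represented by functions rather than by classes
   modulo equality almost everywhere. *)
Definition L2 : set (R -> R) := [set f | f \in Lfun mu 2%:E].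

Definition L2norm (f : R -> R) : \bar R := 'N[mu]_2%:E [EFin \o f].

Definition L2inner (f g : R -> R) : R := \int[mu]_x (f x * g x).

Definition linear_span (S : set (R -> R)) : set (R -> R) :=
  [set g | exists (k : nat) (c : 'I_k -> R) (h : 'I_k -> R -> R),
     (forall i, S (h i)) /\ g = (fun x => \sum_(i < k) c i * h i x)].

(* Since [L2norm] is only a seminorm on functions, a closed span is stable
   under equality almost everywhere among measurable functions. *)
Definition closed_span (S : set (R -> R)) : set (R -> R) :=
  [set f | L2 f /\ forall e : R, 0 < e ->
     exists2 g, linear_span S g & (L2norm (f \- g)%R < e%:E)%E].

(* The two-sided bound over finite families extends to all square-summable
   coefficient families, and gives the unconditional expansions in [V]. *)
Definition is_riesz_basis (I : eqType) (e : I -> R -> R)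
    (V : set (R -> R)) : Prop :=
  closed_span (range e) = V /\
  exists A B : R, [/\ 0 < A, 0 < B &
    forall (s : seq I) (c : I -> R), uniq s ->
      ((A * \sum_(i <- s) c i ^+ 2)%:E
         <= L2norm (fun x => \sum_(i <- s) c i * e i x)%R ^+ 2
         <= (B * \sum_(i <- s) c i ^+ 2)%:E)%E].

Definition is_orthogonal_basis (I : eqType) (e : I -> R -> R)
    (V : set (R -> R)) : Prop :=
  [/\ closed_span (range e) = V,
      forall i, L2norm (e i) != 0%E &
      forall i j, i != j -> L2inner (e i) (e j) = 0].

Definition compactly_supported (f : R -> R) : Prop :=
  compact (closure [set x | f x != 0]).

End L2.

Section MRA.
Context {R : realType} (r : nat) (Phi : 'I_r.+1 -> R -> R).

Definition translates (ij : 'I_r.+1 * int) : R -> R :=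
  fun x => Phi ij.1 (x - ij.2%:~R).

Definition V0 : set (R -> R) := closed_span (range translates).

Definition V (p : int) : set (R -> R) :=
  [set g | exists2 f, V0 f & g = (fun x : R => f (2 ^ p * x))].

Definition generates_MRA : Prop :=
  [/\ forall i, L2 (Phi i) /\ compactly_supported (Phi i),
      forall p : int, V p `<=` V (p + 1) &
      is_riesz_basis translates V0].

Definition generates_orthogonal_MRA : Prop :=
  generates_MRA /\ is_orthogonal_basis translates V0.

End MRA.

Section SpecialFunctions.
Context {R : realType}.
Local Notation mu := (@lebesgue_measure R).

Definition pochhammer (a : R) (j : nat) : R := \prod_(i < j) (a + i%:R).

Definition hypergeometric (a b : seq R) (t : R) : R :=
  limn (series (fun i : nat =>
    (\prod_(x <- a) pochhammer x i) /
      ((\prod_(y <- b) pochhammer y i) * i`!%:R) * t ^+ i)).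

Definition is_monic_jacobi (alpha beta : R) (n : nat) (p : {poly R}) : Prop :=
  [/\ p \is monic, size p = n.+1 &
      forall q : {poly R}, (size q <= n)%N ->
        \int[mu]_(x in `[-1, 1])
          (p.[x] * q.[x] * ((1 - x) `^ alpha * (1 + x) `^ beta)) = 0].

(* For [alpha, beta > -1] exactly one polynomial satisfies
   [is_monic_jacobi alpha beta n]; the default value [0] is then irrelevant. *)
Definition monic_jacobi (alpha beta : R) (n : nat) : {poly R} :=
  xget 0 [set p | is_monic_jacobi alpha beta n p].

Definition monic_ultraspherical (lambda : R) (n : nat) : {poly R} :=
  monic_jacobi (lambda - 1 / 2) (lambda - 1 / 2) n.

Fixpoint double_fact (n : nat) : nat :=
  match n with
  | n'.+2 => (n * double_fact n')%N
  | _ => 1%N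
  end.

Definition phi0 (j : nat) (t : R) : R :=
  (1 - t ^+ 2) * (monic_ultraspherical (5 / 2) (j - 2)%N).[t].

Definition f_eps (eps m n : nat) (t : R) : R :=
  let e : R := eps%:R in
  let M : R := m%:R in
  let N : R := n%:R in
  t ^+ eps *
  ((pochhammer (1 / 2 + e) n * (N ^+ 2 + (3 / 2 + e) * N + M + 1 + e) *
      pochhammer (- M + 1 / 2) n) /
   (pochhammer (M + 1 + e) n.+1 * (n.+1)`!%:R)) *
  hypergeometric
    [:: - N; - N ^+ 2 - (3 / 2 + e) * N - M - e; - M - 1 / 2; N + 3 / 2 + e]
    [:: 1 / 2 + e; - N ^+ 2 - (3 / 2 + e) * N - M - 1 - e; - M + 1 / 2]
    (t ^+ 2).

End SpecialFunctions.

Section Generators.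
Context {R : realType} (n : nat).

(* The function $w_{4n,2n}$. *)
Definition w (t : R) : R :=
  - `|t| * t ^+ (2 * n - 1) + f_eps 1 (n - 1) (2 * n - 1) t.

Definition q_r (t : R) : R :=
  (2 * (double_fact (8 * n + 1)%N)%:R) / ((4 * n + 2)`!)%N%:R *
    (1 + t) * (monic_jacobi 1 2 (4 * n - 1)).[t]
  - ((-1) ^+ n * 2 ^+ (4 * n) * (n`!)%N%:R * ((3 * n)`!)%N%:R) /
      (((2 * n + 1)`!)%N%:R * ((2 * n)`!)%N%:R) * w t.

Definition q_l (t : R) : R := q_r (- t).

Definition phi_tilde (j : nat) (t : R) : R :=
  match j with
  | 0 => if -1 <= t < 0 then q_r (2 * t + 1)
         else if 0 <= t < 1 then q_l (2 * t - 1) else 0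
  | 1 => if 0 <= t < 1 then w (2 * t - 1) else 0
  | _ => if 0 <= t < 1 then phi0 j (2 * t - 1) else 0
  end.

(* The vector $\Phi_{4n}$, with entries indexed by $0, \dots, 4n$. *)
Definition Phi4n : 'I_(4 * n).+1 -> R -> R := fun j => phi_tilde j.

End Generators.

(* Main.v *)
Require Import Defs.
From HB Require Import structures.
From mathcomp Require Import all_boot all_order all_algebra.
From mathcomp Require Import all_classical all_reals all_analysis.
From mathcomp Require Import measurable_realfun polyrcf ring lra zify.

(** On an interval of V_0 the functions are the polynomials of degree at most
    4n together with one function w having a knot at the midpoint.  Restricted
    to a half interval all of them are polynomials of degree at most 4n, and
    they are glued continuously at the integers; this gives V_0 <= V_1.

    For orthogonality, split on [-1, 1] the polynomial r = (I - P)(1 + t) into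
    its even part e and odd part o, so that q_r = e + (o - C w) and
    q_l = e - (o - C w) with w odd.  Orthogonality to the polynomials vanishing
    at 1 and -1 says that the moments of e (resp. o, w) against the even (resp.
    odd) powers t^j of low degree do not depend on j.  The moments of
    sum_k c_k t^(e_k) on [0, 1] are the values of the rational function
    sum_k c_k / (s + e_k + 1); when it takes one value mu at as many points s_i
    as it has poles, it equals mu (1 - prod_i (s - s_i) / (s + e_i + 1)).  Its
    behaviour at infinity then yields mu, and all the inner products needed
    are explicit: |o|^2 - |e|^2 = <o, w>^2 / |w|^2 is exactly <q_r, q_l> = 0.
    The 4F3 coefficients of w are the residues of such a function. *)

Set Implicit Arguments.
Unset Strict Implicit.
Unset Printing Implicit Defensive.

Import Order.TTheory GRing.Theory Num.Theory.
Import numFieldNormedType.Exports.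

Local Open Scope classical_set_scope.
Local Open Scope ring_scope.

(** * Integrals of polynomials and partial fractions *)

Section PolyIntegral.
Variable R : rcfType.
Implicit Types (p q : {poly R}) (a b c d : R).

(** Continuous piecewise polynomials of degree 4n are nested, but the hats made of r and its
    reflection are not orthogonal to their neighbours: that inner product is a positive multiple of
    |e|^2 - |o|^2 (norms on [0, 1]), which is not 0. One function w added to every cell can repair
    this, and nestedness survives if w is continuous, vanishes at both ends and is a polynomial of
    degree at most 4n on each half cell. Let w be odd with knot term -|t| t^(2l-1). Orthogonality to
    the functions (1 - t^2) s prescribes the points s_i = 1, 3, ..., 4n - 1, one fewer than the 2n +
    1 poles, and w(1) = 0 fixes the remaining point. The outcome is <o, w>^2 / |w|^2 = (4l + 1) /
    (2n (4n + 1) (8n^2 + 2n + 4l + 1)), whereas |o|^2 - |e|^2 = 1 / (2n (2n + 1) (4n + 1)). They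
    agree exactly for l = n, which is the origin of the exponent in w. As w is itself a generator,
    correcting the hat by multiples of w does not change the span. *)

Definition primitive p : {poly R} := \poly_(i < (size p).+1) (p`_i.-1 / i%:R).

(** The integral as an algebraic functional, so that ring identities and parity arguments involve no
    measurability; [Rintegral_segment_poly] ties it to the Lebesgue integral. It changes sign when
    the bounds are exchanged. *)
Definition pint a b p : R := (primitive p).[b] - (primitive p).[a].

Lemma deriv_primitive p : (primitive p)^`() = p.
Proof.
apply/polyP => i; rewrite coef_deriv coef_poly ltnS.
case: ltnP => [ip|pi]; last by rewrite mul0rn nth_default.
by rewrite -[LHS]mulr_natr divfK // pnatr_eq0.
Qed.

Lemma deriv_eq0 p : p^`() = 0 -> p = (p`_0)%:P.
Proof.
move=> p'0; apply/polyP => -[|i]; rewrite coefC //=.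
by have /eqP := congr1 (fun q : {poly R} => q`_i) p'0; rewrite coef_deriv coef0 mulrn_eq0 => /eqP.
Qed.

Lemma pintE q p a b : q^`() = p -> pint a b p = q.[b] - q.[a].
Proof.
move=> qp; have /deriv_eq0 : (primitive p - q)^`() = 0 by rewrite derivB deriv_primitive qp subrr.
set k := _`_0 => /eqP; rewrite subr_eq => /eqP E; rewrite /pint E !hornerD !hornerC; ring.
Qed.

Lemma pintD a b p q : pint a b (p + q) = pint a b p + pint a b q.
Proof.
rewrite (@pintE (primitive p + primitive q)) ?derivD ?deriv_primitive //.
rewrite /pint !hornerD; ring.
Qed.

Lemma pintZ a b c p : pint a b (c *: p) = c * pint a b p.
Proof. by rewrite (@pintE (c *: primitive p)) ?derivZ ?deriv_primitive // !hornerZ -mulrBr. Qed.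

Lemma pintN a b p : pint a b (- p) = - pint a b p.
Proof. by rewrite -scaleN1r pintZ mulN1r. Qed.

Lemma pintB a b p q : pint a b (p - q) = pint a b p - pint a b q.
Proof. by rewrite pintD pintN. Qed.

Lemma pint0 a b : pint a b 0 = 0.
Proof. by rewrite -(scale0r 0) pintZ mul0r. Qed.

Lemma pint_sum I (r : seq I) (P : pred I) (F : I -> {poly R}) a b :
  pint a b (\sum_(i <- r | P i) F i) = \sum_(i <- r | P i) pint a b (F i).
Proof. by apply: (big_morph (pint a b)) => [p q|]; rewrite ?pintD ?pint0. Qed.

Lemma pint_split c a b p : pint a b p = pint a c p + pint c b p.
Proof. rewrite /pint; ring. Qed.

Lemma pint_affine c d a b p :
  c * pint a b (p \Po (c *: 'X + d%:P)) = pint (c * a + d) (c * b + d) p.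
Proof.
rewrite -pintZ (@pintE (primitive p \Po (c *: 'X + d%:P))) ?horner_comp ?hornerE //.
by rewrite deriv_comp deriv_primitive derivD derivZ derivX derivC addr0 mulrC alg_polyC mul_polyC.
Qed.

Lemma pint01Xn k : pint 0 1 'X^k = k.+1%:R^-1.
Proof.
rewrite (@pintE (k.+1%:R^-1 *: 'X^(k.+1))); last first.
  by rewrite derivZ derivXn -scalerMnr scalerMnl -[_^-1 *+ _]mulr_natr mulVf ?scale1r // pnatr_eq0.
by rewrite !hornerE expr1n mulr1 exprS mul0r mulr0 subr0.
Qed.

(** The primitive is monotone on [a, b]. Equal values at the ends would make it constant there,
    hence constant as a polynomial, and its derivative p would be 0. *)
Lemma pint_gt0 a b p : a < b -> (forall x, a < x < b -> 0 <= p.[x]) -> p != 0 ->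
  0 < pint a b p.
Proof.
move=> ab p_ge0 p_neq0.
have mono u v : a <= u -> u <= v -> v <= b -> (primitive p).[u] <= (primitive p).[v].
  move=> au uv vb; case: (ltrgtP u v) uv => // [uv _|-> //].
  have [c /itvP cuv] := poly_mvt (primitive p) uv.
  rewrite deriv_primitive => /eqP; rewrite subr_eq => /eqP ->.
  rewrite lerDr mulr_ge0 ?subr_ge0 1?(ltW uv) // p_ge0 //.
  by rewrite (le_lt_trans au) ?cuv //= (lt_le_trans _ vb) ?cuv.
have leab : (primitive p).[a] <= (primitive p).[b] by apply: mono; rewrite ?lexx ?ltW.
rewrite lt_neqAle /pint subr_ge0 leab andbT eq_sym subr_eq0.
apply: contraNneq p_neq0 => /= Eab.
rewrite -(deriv_primitive p); set q := primitive p in mono Eab *.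
suff -> : q = (q.[a])%:P by rewrite derivC.
apply/eqP; rewrite -subr_eq0; set h := q - _; apply/eqP.
(* Distinct points of ]a, b], as many as the size of h, which forces h = 0. *)
pose s := [seq a + (b - a) / i.+1%:R | i <- iota 0 (size h)].
apply: (@roots_geq_poly_eq0 _ h s) => //; last by rewrite size_map size_iota.
  apply/allP => _ /mapP[i _ ->]; rewrite rootE !hornerE subr_eq0.
  have ba0 : 0 <= b - a by rewrite subr_ge0 ltW.
  have h1 : a <= a + (b - a) / i.+1%:R by rewrite lerDl divr_ge0.
  have h2 : a + (b - a) / i.+1%:R <= b.
    by rewrite -lerBrDl ler_pdivrMr ?ltr0n // ler_peMr // ler1n.
  by apply/eqP/le_anti; rewrite -{1}Eab !mono ?lexx.
rewrite map_inj_uniq ?iota_uniq // => i j /addrI /(mulfI _).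
rewrite subr_eq0 gt_eqF // => /(_ isT) /invr_inj /eqP.
by rewrite eqr_nat eqSS => /eqP.
Qed.

Lemma pint_ge0 a b p : a < b -> (forall x, a < x < b -> 0 <= p.[x]) -> 0 <= pint a b p.
Proof.
move=> ab p0; have [->|/(pint_gt0 ab p0)/ltW //] := eqVneq p 0.
by rewrite pint0.
Qed.

End PolyIntegral.

Section PartialFractions.
Variables (R : rcfType) (d : nat).
Implicit Types (c y s : 'I_d -> R) (mu t : R).

Lemma horner_prod_XsubC (P : pred 'I_d) y t :
  (\prod_(i | P i) ('X - (y i)%:P)).[t] = \prod_(i | P i) (t - y i).
Proof.
rewrite (big_morph (fun p : {poly R} => p.[t]) (fun p q => hornerM p q t) (hornerC 1 t)).
by apply: eq_bigr => i _; rewrite !hornerE.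
Qed.

Lemma size_prod_ord_XsubC y : size (\prod_j ('X - (y j)%:P)) = d.+1.
Proof. by rewrite size_prod_XsubC /index_enum -enumT size_enum_ord. Qed.

Lemma size_prod_ordC1_XsubC k y : size (\prod_(j | j != k) ('X - (y j)%:P)) = d.
Proof.
rewrite -big_filter size_prod_XsubC size_filter -sum1_count.
by rewrite (sum1_card (predC1 k)) cardC1 card_ord prednK // (leq_trans _ (ltn_ord k)).
Qed.

Lemma coef_pred_prod_XsubC y : (0 < d)%N ->
  (\prod_j ('X - (y j)%:P))`_d.-1 = - \sum_j y j.
Proof.
move=> d0; rewrite -(big_map y xpredT (fun a => 'X - a%:P)) -(big_map y xpredT id).
set t := map _ _; have Et : size t = d by rewrite size_map /index_enum -enumT size_enum_ord.
by rewrite -{1}Et coefPn_prod_XsubC // Et -lt0n.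
Qed.

Lemma size_sub_prod_XsubC y s :
  (size (\prod_j ('X - (y j)%:P) - \prod_j ('X - (s j)%:P))%R <= d)%N.
Proof.
apply/leq_sizeP => j; rewrite leq_eqVlt coefB => /orP[/eqP <-|dj].
  have E (z : 'I_d -> R) : (\prod_j ('X - (z j)%:P))`_d = 1.
    by have := lead_coef_prod_XsubC (index_enum 'I_d) xpredT z; rewrite lead_coefE size_prod_ord_XsubC.
  by rewrite !E subrr.
by rewrite !nth_default ?subrr // size_prod_ord_XsubC.
Qed.

(** The numerator of \sum_k c k / (t - y k) over the common denominator \prod_j (t - y j). *)
Definition pf_num c y : {poly R} := \sum_k c k *: \prod_(j | j != k) ('X - (y j)%:P).

Lemma size_pf_num c y : (size (pf_num c y) <= d)%N.
Proof.
rewrite (leq_trans (size_sum _ _ _)) //; apply/bigmax_leqP => k _.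
by rewrite (leq_trans (size_scale_leq _ _)) // size_prod_ordC1_XsubC.
Qed.

Lemma coef_pred_pf_num c y : (pf_num c y)`_d.-1 = \sum_k c k.
Proof.
rewrite coef_sum; apply: eq_bigr => k _; rewrite coefZ.
have := lead_coef_prod_XsubC (index_enum 'I_d) (fun j => j != k) y.
by rewrite lead_coefE size_prod_ordC1_XsubC => ->; rewrite mulr1.
Qed.

Lemma horner_pf_num_node c y k :
  (pf_num c y).[y k] = c k * \prod_(j | j != k) (y k - y j).
Proof.
rewrite horner_sum [LHS](bigD1 k) //= hornerZ horner_prod_XsubC [X in _ + X]big1 ?addr0 // => i ik.
by rewrite hornerZ horner_prod_XsubC (bigD1 k) 1?eq_sym //= subrr mul0r mulr0.
Qed.

Lemma horner_pf_num c y t : (forall k, t != y k) ->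
  (pf_num c y).[t] = (\sum_k c k / (t - y k)) * \prod_j (t - y j).
Proof.
move=> ty; rewrite horner_sum mulr_suml; apply: eq_bigr => k _.
rewrite hornerZ horner_prod_XsubC [X in _ = _ * X](bigD1 k) //= mulrA divfK //.
by rewrite subr_eq0 ty.
Qed.

(** The identity \sum_k c k / (t - y k) = mu (1 - \prod_i (t - s i) / (t - y i)), cleared of
    denominators so that it can also be evaluated at the poles, where it gives the residues. *)
Definition pf_spec c y s mu : Prop :=
  pf_num c y = mu *: (\prod_j ('X - (y j)%:P) - \prod_i ('X - (s i)%:P)).

Lemma poly_ord_eq0 (p : {poly R}) s : injective s -> (size p <= d)%N ->
  (forall i, p.[s i] = 0) -> p = 0.
Proof.
move=> s_inj pd p0; apply: (@roots_geq_poly_eq0 _ _ (map s (enum 'I_d))).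
- by apply/allP => _ /mapP[i _ ->]; rewrite rootE p0.
- by rewrite map_inj_uniq ?enum_uniq.
- by rewrite size_map size_enum_ord.
Qed.

(* Both sides have degree less than [d] and agree at the [d] points [s i],
   resp. [y k]. *)
Lemma pf_spec_values c y s mu : injective s -> (forall i k, s i != y k) ->
  (forall i, \sum_k c k / (s i - y k) = mu) -> pf_spec c y s mu.
Proof.
move=> s_inj sy E; apply/eqP; rewrite -subr_eq0; apply/eqP.
apply: (poly_ord_eq0 s_inj) => [|i].
  rewrite (leq_trans (size_polyD _ _)) // geq_max size_pf_num size_polyN.
  by rewrite (leq_trans (size_scale_leq _ _)) // size_sub_prod_XsubC.
rewrite hornerD hornerN hornerZ hornerD hornerN horner_pf_num // E !horner_prod_XsubC.
have -> : \prod_j (s i - s j) = 0 by rewrite (bigD1 i) //= subrr mul0r.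
by rewrite subr0 subrr.
Qed.

Lemma pf_spec_residues c y s mu : injective y ->
  (forall k, c k * \prod_(j | j != k) (y k - y j) = - mu * \prod_i (y k - s i)) ->
  pf_spec c y s mu.
Proof.
move=> y_inj E; apply/eqP; rewrite -subr_eq0; apply/eqP.
apply: (poly_ord_eq0 y_inj) => [|k].
  rewrite (leq_trans (size_polyD _ _)) // geq_max size_pf_num size_polyN.
  by rewrite (leq_trans (size_scale_leq _ _)) // size_sub_prod_XsubC.
rewrite hornerD hornerN hornerZ hornerD hornerN horner_pf_num_node E !horner_prod_XsubC.
have -> : \prod_j (y k - y j) = 0 by rewrite (bigD1 k) //= subrr mul0r.
ring.
Qed.

Lemma pf_spec_residue c y s mu : pf_spec c y s mu ->
  forall k, c k * \prod_(j | j != k) (y k - y j) = - mu * \prod_i (y k - s i).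
Proof.
move=> E k; rewrite -horner_pf_num_node E hornerZ hornerD hornerN !horner_prod_XsubC.
have -> : \prod_j (y k - y j) = 0 by rewrite (bigD1 k) //= subrr mul0r.
by rewrite sub0r mulrN mulNr.
Qed.

(* Compare the coefficients of degree [d - 1]. *)
Lemma pf_spec_sum c y s mu : (0 < d)%N -> pf_spec c y s mu ->
  \sum_k c k = mu * (\sum_i s i - \sum_k y k).
Proof.
move=> d0 E; rewrite -(coef_pred_pf_num c y) E coefZ coefB !coef_pred_prod_XsubC //.
by rewrite opprK addrC.
Qed.

Lemma pf_spec_value c y s mu t : pf_spec c y s mu -> (forall k, t != y k) ->
  \sum_k c k / (t - y k) = mu * (1 - \prod_i ((t - s i) / (t - y i))).
Proof.
move=> E ty; have D0 : \prod_j (t - y j) != 0.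
  by apply/prodf_neq0 => j _; rewrite subr_eq0.
apply: (mulIf D0); rewrite -horner_pf_num // E hornerZ hornerD hornerN !horner_prod_XsubC.
by rewrite prodf_div -mulrA mulrBl mul1r divfK.
Qed.

End PartialFractions.

(** * Square-integrable functions *)

Section SquareIntegrable.
Context {R : realType}.
Local Notation mu := (@lebesgue_measure R).
Implicit Types f g h : R -> R.

Lemma L2_measurable f : L2 f -> measurable_fun setT f.
Proof. by rewrite /L2 /= => /sub_Lfun_mfun; rewrite inE. Qed.

Lemma L2_mul f g : L2 f -> L2 g -> mu.-integrable setT (EFin \o (f \* g)).
Proof. by move=> L2f L2g; apply/Lfun1_integrable/Lfun2_mul_Lfun1. Qed.

Lemma sqr_powR2 (a : R) : `|a| `^ 2 = a ^+ 2.
Proof. by rewrite powR_mulrn // real_normK ?num_real. Qed.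

Lemma L2I f : measurable_fun setT f ->
  mu.-integrable setT (EFin \o (fun x => f x ^+ 2)) -> L2 f.
Proof.
move=> mf If; rewrite /L2 /= inE; apply/andP; split; rewrite inE //=.
rewrite /finite_norm unlock poweR_lty //=.
have /integrableP[_] := If; apply: le_lt_trans.
rewrite le_eqVlt; apply/orP; left; apply/eqP/eq_integral => x _.
by rewrite /= sqr_powR2 ger0_norm // sqr_ge0.
Qed.

Lemma L2norm_sqrt f : L2 f -> L2norm f = (Num.sqrt (L2inner f f))%:E.
Proof.
move=> L2f; rewrite /L2norm unlock -powR12_sqrt; last first.
  by apply: Rintegral_ge0 => x _; rewrite -expr2 sqr_ge0.
rewrite -poweR_EFin /L2inner /Rintegral fineK; last first.
  by apply: integrable_fin_num => //; exact: L2_mul.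
by congr (_ `^ _)%E; apply: eq_integral => x _; rewrite /= sqr_powR2.
Qed.

Lemma L2inner_ge0 f : 0 <= L2inner f f.
Proof. by apply: Rintegral_ge0 => x _; rewrite -expr2 sqr_ge0. Qed.

Lemma L2norm_sqr f : L2 f -> (L2norm f ^+ 2 = (L2inner f f)%:E)%E.
Proof. by move=> /L2norm_sqrt ->; rewrite -EFin_expe sqr_sqrtr // L2inner_ge0. Qed.

Lemma L2D f g : L2 f -> L2 g -> L2 (fun x => f x + g x).
Proof.
have h : (1 <= 2%:E :> \bar R)%E by rewrite lee_fin ler1n.
by move=> L2f L2g; have /= := (Lfun_addr_closed mu h).2 f g L2f L2g.
Qed.

Lemma L2Z a f : L2 f -> L2 (fun x => a * f x).
Proof.
move=> L2f; have -> : (fun x => a * f x) = a \o* f by apply/funext => x /=; rewrite mulrC.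
by apply: Lfun_scale => //; rewrite ler1n.
Qed.

Lemma L2B f g : L2 f -> L2 g -> L2 (f \- g).
Proof.
move=> L2f L2g; have -> : f \- g = (fun x => f x + -1 * g x).
  by apply/funext => x; rewrite mulN1r.
by apply: L2D => //; exact: L2Z.
Qed.

Lemma L20 : L2 (fun _ : R => 0).
Proof.
have h : (1 <= 2%:E :> \bar R)%E by rewrite lee_fin ler1n.
exact: (Lfun_addr_closed mu h).1.
Qed.

Lemma L2_sum I (s : seq I) (F : I -> R -> R) : (forall i, L2 (F i)) ->
  L2 (fun x => \sum_(i <- s) F i x).
Proof.
move=> L2F; elim: s => [|i s IH].
  by under eq_fun do rewrite big_nil; exact: L20.
by under eq_fun do rewrite big_cons; exact: L2D.
Qed.

Lemma L2innerDl f g h : L2 f -> L2 g -> L2 h ->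
  L2inner (fun x => f x + g x) h = L2inner f h + L2inner g h.
Proof.
move=> L2f L2g L2h; rewrite /L2inner -RintegralD //; try exact: L2_mul.
by apply: eq_Rintegral => x _; rewrite mulrDl.
Qed.

Lemma L2innerZl a f h : L2 f -> L2 h -> L2inner (fun x => a * f x) h = a * L2inner f h.
Proof.
move=> L2f L2h; rewrite /L2inner -RintegralZl //; last exact: L2_mul.
by apply: eq_Rintegral => x _; rewrite mulrA.
Qed.

Lemma L2innerC f h : L2inner f h = L2inner h f.
Proof. by apply: eq_Rintegral => x _; rewrite mulrC. Qed.

Lemma L2inner0l h : L2inner (fun _ => 0) h = 0.
Proof.
rewrite /L2inner (@eq_Rintegral _ _ _ mu setT (cst 0)) => [|x _]; last by rewrite mul0r.
by rewrite /Rintegral integral0.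
Qed.

Lemma L2inner_suml I (s : seq I) (F : I -> R -> R) h : (forall i, L2 (F i)) -> L2 h ->
  L2inner (fun x => \sum_(i <- s) F i x) h = \sum_(i <- s) L2inner (F i) h.
Proof.
move=> L2F L2h; elim: s => [|i s IH].
  by under eq_fun do rewrite big_nil; rewrite L2inner0l big_nil.
under eq_fun do rewrite big_cons.
by rewrite L2innerDl ?IH ?big_cons //; exact: L2_sum.
Qed.

Lemma L2inner_sum_sqr (I : eqType) (e : I -> R -> R) (s : seq I) (c : I -> R) :
  (forall i, L2 (e i)) -> (forall i j, i != j -> L2inner (e i) (e j) = 0) -> uniq s ->
  L2inner (fun x => \sum_(i <- s) c i * e i x) (fun x => \sum_(i <- s) c i * e i x) =
  \sum_(i <- s) c i ^+ 2 * L2inner (e i) (e i).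
Proof.
move=> L2e orth us; have L2S : L2 (fun x => \sum_(i <- s) c i * e i x).
  by apply: L2_sum => i; exact: L2Z.
rewrite L2inner_suml //; last by move=> i; exact: L2Z.
apply: eq_big_seq => i si; rewrite L2innerZl // L2innerC L2inner_suml //; last by move=> j; exact: L2Z.
rewrite (bigD1_seq i) //= L2innerZl // big1 ?addr0; first by ring.
by move=> j ji; rewrite L2innerZl // orth ?mulr0.
Qed.

(** By Pythagoras, uniform bounds on the squared norms are already Riesz bounds. *)
Lemma orthogonal_riesz (I : eqType) (e : I -> R -> R) (A B : R) :
  0 < A -> 0 < B ->
  (forall i, L2 (e i)) -> (forall i, A <= L2inner (e i) (e i) <= B) ->
  (forall i j, i != j -> L2inner (e i) (e j) = 0) ->
  is_riesz_basis e (closed_span (range e)) /\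
  is_orthogonal_basis e (closed_span (range e)).
Proof.
move=> A0 B0 L2e AB orth; split.
  split=> //; exists A, B; split=> // s c us.
  rewrite L2norm_sqr; last by apply: L2_sum => i; exact: L2Z.
  rewrite L2inner_sum_sqr // !lee_fin !mulr_sumr; apply/andP; split.
    apply: ler_sum => i _; rewrite mulrC ler_wpM2l ?sqr_ge0 //.
    by case/andP: (AB i).
  apply: ler_sum => i _; rewrite [leRHS]mulrC ler_wpM2l ?sqr_ge0 //.
  by case/andP: (AB i).
split=> // i; rewrite L2norm_sqrt //.
have /andP[h _] := AB i.
by rewrite gt_eqF // lte_fin sqrtr_gt0 (lt_le_trans A0).
Qed.

(** Lebesgue measure is determined by its values on half-open intervals, where the rescaled
    pushforward under x / a is computed directly. *)
Lemma lebesgue_measure_dilation (a : R) (A : set R) : 0 < a -> measurable A ->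
  mu A = (a^-1%:E * mu ((fun x : R => (x / a)%R) @^-1` A))%E.
Proof.
move=> a0 mA.
pose phi (x : measurableTypeR R) : measurableTypeR R := (x : R) / a.
have mphi : measurable_fun [set: measurableTypeR R] phi by exact: measurable_funM.
have a'0 : 0 <= a^-1 by rewrite invr_ge0 ltW.
pose nu : {measure set (measurableTypeR R) -> \bar R} :=
  mscale (NngNum a'0)
    (measure_function_pushforward__canonical__measure_function_Measure mu mphi).
suff h X : ocitv X -> lebesgue_measure X = nu X.
  by rewrite (@lebesgue_measure_unique R nu h A mA).
move=> [[x y] _ <-] /=.
rewrite /nu /mscale /= /pushforward.
have -> : phi @^-1` `]x, y]%classic = `]a * x, a * y]%classic.
  by apply/seteqP; split => z /=; rewrite !in_itv /= ltr_pdivlMr // ler_pdivrMr // !(mulrC a).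
rewrite !lebesgue_measure_itv /= !lte_fin ltr_pM2l //; case: ifPn => _; last by rewrite mule0.
by rewrite -!EFinD -EFinM -mulrBr mulKf // gt_eqF.
Qed.

Lemma integral_dilation (a : R) (g : R -> R) : 0 < a ->
  measurable_fun setT g -> (forall x, 0 <= g x) ->
  (\int[mu]_x (g (x / a))%:E = a%:E * \int[mu]_x (g x)%:E)%E.
Proof.
move=> a0 mg g0.
pose phi (x : measurableTypeR R) : measurableTypeR R := (x : R) / a.
have mphi : measurable_fun [set: measurableTypeR R] phi by exact: measurable_funM.
pose gE (x : measurableTypeR R) := (g x)%:E.
have mgE : measurable_fun [set: measurableTypeR R] gE by exact/measurable_EFinP.
have gE0 x : (0 <= gE x)%E by rewrite lee_fin.
have := @ge0_integral_pushforward _ _ _ _ R phi mphi mu setT gE measurableT mgE (fun x _ => gE0 x).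
rewrite preimage_setT => <-.
have := @ge0_integral_mscale _ _ R mu setT measurableT (NngNum (ltW a0)) gE mgE (fun x _ => gE0 x).
move=> /= <-; apply: eq_measure_integral => A mA _.
apply/esym/(etrans (congr1 (mule a%:E) (lebesgue_measure_dilation a0 mA))).
by rewrite muleA -EFinM divff ?gt_eqF // mul1e.
Qed.

Lemma L2_dilation (a : R) f : 0 < a -> L2 f ->
  L2 (fun x => f (x / a)) /\
  L2inner (fun x => f (x / a)) (fun x => f (x / a)) = a * L2inner f f.
Proof.
move=> a0 L2f; have mf := L2_measurable L2f.
have If := Lfun2_integrable_sqr L2f.
have E := integral_dilation a0 (measurable_funX 2 mf) (fun x => sqr_ge0 (f x)).
have mfa : measurable_fun setT (fun x : R => f (x / a)).
  have mphi : measurable_fun [set: measurableTypeR R] (fun x : R => x / a).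
    exact: measurable_funM.
  exact: (measurableT_comp mf mphi).
split.
  apply: L2I => //; apply/integrableP; split.
    by apply/measurable_EFinP; exact: measurable_funX.
  under eq_integral => x _ do rewrite /= ger0_norm ?sqr_ge0 //.
  rewrite E lte_mul_pinfty ?lee_fin ?ltW //.
  have /integrableP[_] := If; apply: le_lt_trans.
  by rewrite le_eqVlt; apply/orP; left; apply/eqP/eq_integral => x _; rewrite /= ger0_norm ?sqr_ge0.
rewrite /L2inner /Rintegral; under eq_integral do rewrite -expr2.
rewrite E fineM //; last exact: integrable_fin_num.
Qed.

End SquareIntegrable.

(** * Spans and piecewise polynomials *)

Section LinearSpan.
Context {R : realType}.
Implicit Types (S : set (R -> R)) (f g : R -> R).

Lemma linear_span_mem S f : S f -> linear_span S f.
Proof.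
move=> Sf; exists 1%N, (fun=> 1), (fun=> f); split => //.
by apply/funext => x; rewrite big_ord1 mul1r.
Qed.

Lemma linear_span_ext S f g : linear_span S f -> f =1 g -> linear_span S g.
Proof. by move=> Sf /funext <-. Qed.

Lemma linear_span0 S : linear_span S (fun=> 0).
Proof.
exists 0%N, (fun=> 0), (fun _ _ => 0); split; first by case.
by apply/funext => x; rewrite big_ord0.
Qed.

Lemma linear_spanZ S a f : linear_span S f -> linear_span S (fun x => a * f x).
Proof.
move=> [k [c [h [Sh ->]]]]; exists k, (fun i => a * c i), h; split => //.
by apply/funext => x; rewrite mulr_sumr; apply: eq_bigr => i _; rewrite mulrA.
Qed.

Lemma linear_spanD S f g : linear_span S f -> linear_span S g ->
  linear_span S (fun x => f x + g x).
Proof.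
move=> [k [c [h [Sh ->]]]] [l [d [e [Se ->]]]].
exists (k + l)%N, (fun i => match fintype.split i with inl j => c j | inr j => d j end),
  (fun i => match fintype.split i with inl j => h j | inr j => e j end); split.
  by move=> i; case: (fintype.split i).
apply/funext => x; rewrite big_split_ord /=; congr (_ + _); apply: eq_bigr => i _.
  by rewrite (unsplitK (inl i)).
by rewrite (unsplitK (inr i)).
Qed.

Lemma linear_span_sum S I (r : seq I) (F : I -> R -> R) :
  (forall i, linear_span S (F i)) -> linear_span S (fun x => \sum_(i <- r) F i x).
Proof.
move=> SF; elim: r => [|i r IH].
  by under eq_fun do rewrite big_nil; exact: linear_span0.
by under eq_fun do rewrite big_cons; exact: linear_spanD.
Qed.

Lemma linear_span_comp S (phi : R -> R) f :
  (forall h, S h -> linear_span S (h \o phi)) ->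
  linear_span S f -> linear_span S (f \o phi).
Proof.
move=> Sphi [k [c [h [Sh ->]]]].
by apply: (@linear_span_sum _ _ _ (fun i x => c i * h i (phi x))) => i; apply/linear_spanZ/Sphi.
Qed.

Lemma linear_span_L2 S f : (forall h, S h -> L2 h) -> linear_span S f -> L2 f.
Proof.
by move=> L2S [k [c [h [Sh ->]]]]; apply: L2_sum => i; apply/L2Z/L2S.
Qed.

End LinearSpan.

(** * Two-scale relations and nested spaces *)

Section Refinement.
Context {R : realType} (r : nat) (Phi : 'I_r.+1 -> R -> R).

Lemma linear_span_translate (k : int) (f : R -> R) :
  linear_span (range (translates Phi)) f ->
  linear_span (range (translates Phi)) (fun x => f (x - k%:~R)).
Proof.
apply: linear_span_comp => _ [[i j] _ <-]; apply: linear_span_mem.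
exists (i, j + k) => //; apply/funext => x; rewrite /translates /= intrD; congr (Phi _ _); ring.
Qed.

(** Writing f(2^p x) as g(2^(p+1) x) with g = f(x / 2) reduces all inclusions to the stability of
    V_0 under f(x / 2). On finite combinations this is the two-scale relation, and dilation is
    bounded in L^2, so it passes to the closure. *)
Lemma refinable_nested : (forall ij, L2 (translates Phi ij)) ->
  (forall i, linear_span (range (translates Phi)) (fun x => Phi i (x / 2))) ->
  forall p : int, V Phi p `<=` V Phi (p + 1).
Proof.
move=> L2Phi refine p _ [f [L2f spf] ->].
have two0 : 0 < 2 :> R by [].
exists (fun y => f (y / 2)); last first.
  by apply/funext => x; rewrite expfzDr // expr1z; congr f; field.
split; first exact: (L2_dilation two0 L2f).1.
(* Dilation by 2 multiplies the norm by the square root of 2, which is below 2, so an approximation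
   within e / 2 is good enough. *)
move=> e e0; have e2 : 0 < e / 2 by rewrite divr_gt0.
have [g spg] := spf _ e2.
have L2g : L2 g by apply: linear_span_L2 spg => _ [ik _ <-].
have L2fg := L2B L2f L2g; have [L2d Ed] := L2_dilation two0 L2fg.
rewrite L2norm_sqrt // lte_fin => fg_lt.
exists (fun y => g (y / 2)).
  apply: (linear_span_comp (phi := fun y => y / 2)) spg => _ [[i k] _ <-].
  have := linear_span_translate (k *+ 2) (refine i).
  rewrite (_ : (fun x => _) = translates Phi (i, k) \o (fun y => y / 2)) //.
  by apply/funext => x; rewrite /translates /=; congr (Phi _ _); rewrite rmorphMn /=; field.
rewrite (_ : (fun x => _) \- _ = (fun x => (f \- g) (x / 2))) // L2norm_sqrt // lte_fin Ed.
rewrite sqrtrM // (le_lt_trans (y := 2 * Num.sqrt (L2inner (f \- g) (f \- g)))) //.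
  rewrite ler_wpM2r ?sqrtr_ge0 // -[leRHS]ger0_norm // -sqrtr_sqr ler_sqrt //.
  by rewrite expr2 ler_pMr // ler1n.
by rewrite mulrC -ltr_pdivlMr.
Qed.

End Refinement.

Section Cells.
Context {R : realType}.
Local Notation mu := (@lebesgue_measure R).
Implicit Types (a b c d : R) (p q : {poly R}).

Definition cell a b p (x : R) := if a <= x < b then p.[x] else 0.

Lemma cell_patch a b p : cell a b p = (horner p) \_ `[a, b[.
Proof.
apply/funext => x; rewrite /cell patchE; congr (if _ then _ else _).
by apply/idP/idP; rewrite inE /= in_itv.
Qed.

Lemma integrable_poly a b p : mu.-integrable `[a, b[ (EFin \o horner p).
Proof.
apply: (@integrableS _ _ _ mu `[a, b]) => //; first exact: subset_itv_co_cc.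
apply: continuous_compact_integrable; first exact: segment_compact.
by apply: continuous_subspaceT; exact: continuous_horner.
Qed.

Lemma integrable_cell a b p : mu.-integrable setT (EFin \o cell a b p).
Proof.
rewrite cell_patch -restrict_EFin; apply/integrable_restrict => //; rewrite setTI.
exact: integrable_poly.
Qed.

Lemma measurable_cell a b p : measurable_fun setT (cell a b p).
Proof. by have /integrableP[/measurable_EFinP] := integrable_cell a b p. Qed.

Lemma cell_mul a b p q : cell a b p \* cell a b q = cell a b (p * q).
Proof. by apply/funext => x; rewrite /= /cell; case: ifP; rewrite ?mulr0 // hornerM. Qed.

Lemma L2_cell a b p : L2 (cell a b p).
Proof.
apply: L2I; first exact: measurable_cell.
have -> : (fun x => cell a b p x ^+ 2) = cell a b (p * p).
  by rewrite -cell_mul; apply/funext => x; rewrite expr2.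
exact: integrable_cell.
Qed.

Lemma Rintegral_segment_poly a b p : a < b ->
  \int[mu]_(x in `[a, b]) p.[x] = pint a b p.
Proof.
move=> ab; rewrite /Rintegral (@continuous_FTC2 _ _ (horner (primitive p))) //.
- by apply: continuous_subspaceT; exact: continuous_horner.
- split.
  + by move=> x _; exact: derivable_horner.
  + by apply/cvg_at_right_filter; exact: continuous_horner.
  + by apply/cvg_at_left_filter; exact: continuous_horner.
- by move=> x _; rewrite -derivE deriv_primitive.
Qed.

Lemma integral_cell a b p : a < b -> \int[mu]_x cell a b p x = pint a b p.
Proof.
move=> ab; rewrite cell_patch -Rintegral_mkcond -Rintegral_segment_poly //.
by rewrite Rintegral_itv_bndo_bndc //; exact: integrable_poly.
Qed.

Lemma L2inner_cell a b p q : a < b -> L2inner (cell a b p) (cell a b q) = pint a b (p * q).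
Proof. by move=> ab; rewrite -integral_cell // -cell_mul. Qed.

Lemma L2inner_cell_disjoint a b c d p q : b <= c -> L2inner (cell a b p) (cell c d q) = 0.
Proof.
move=> bc; rewrite /L2inner (@eq_Rintegral _ _ _ mu setT (cst 0)) => [|x _].
  by rewrite /Rintegral integral0.
rewrite /cell; case: ifP => [/andP[_ xb]|]; rewrite ?mul0r //.
by rewrite leNgt (lt_le_trans xb bc) /= mulr0.
Qed.

End Cells.

Section Pieces.
Context {R : realType}.
Implicit Types (P Q : {poly R}) (u v : R -> R) (k l : int).

(* Functions of [t] on [-1, 1] that are polynomial on each half are encoded by
   the polynomial for [t >= 0] and the polynomial in [- t] for [t < 0]. *)
Definition halves P Q (t : R) : R := if t < 0 then Q.[- t] else P.[t].

Definition piece u k (x : R) : R :=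
  if k%:~R <= x < k%:~R + 1 then u (2 * (x - k%:~R) - 1) else 0.

Lemma piece_halves P Q k : let a : R := k%:~R in
  piece (halves P Q) k = (fun x =>
    cell a (a + 2^-1) (Q \Po (- 2 *: 'X + (2 * a + 1)%:P)) x +
    cell (a + 2^-1) (a + 1) (P \Po (2 *: 'X + (- (2 * a + 1))%:P)) x).
Proof.
move=> a; apply/funext => x; rewrite /piece /cell /halves -/a !horner_comp !(hornerD, hornerZ, hornerX, hornerC).
have -> : - (2 * (x - a) - 1) = - 2 * x + (2 * a + 1) by ring.
have -> : 2 * (x - a) - 1 = 2 * x - (2 * a + 1) by ring.
case: (ltP x (a + 2^-1)) => xa.
  have -> : x < a + 1 by lra.
  have -> : 2 * x - (2 * a + 1) < 0 by lra.
  by rewrite /= andbT addr0.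
have -> : 2 * x - (2 * a + 1) < 0 = false by lra.
have -> : a <= x by lra.
by rewrite /= add0r.
Qed.

Lemma L2_piece P Q k : L2 (piece (halves P Q) k).
Proof. by rewrite piece_halves; apply: L2D; exact: L2_cell. Qed.

(** Storing the left half in the variable -t turns both contributions into integrals over [0, 1];
    the factor 1/2 comes from the affine map of slope 2 in [piece]. *)
Lemma L2inner_piece P Q P' Q' k :
  L2inner (piece (halves P Q) k) (piece (halves P' Q') k) =
  (pint 0 1 (P * P') + pint 0 1 (Q * Q')) / 2.
Proof.
rewrite !piece_halves; set a : R := k%:~R.
rewrite L2innerDl; [|exact: L2_cell|exact: L2_cell|by apply: L2D; exact: L2_cell].
rewrite !(L2innerC _ (fun x => _ + _)) !L2innerDl; try exact: L2_cell.
rewrite !L2inner_cell; try lra.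
rewrite (L2innerC (cell (a + 2^-1) _ _)) !L2inner_cell_disjoint // add0r addr0.
rewrite -!rmorphM /=.
have := pint_affine (- 2) (2 * a + 1) a (a + 2^-1) (Q' * Q).
have := pint_affine 2 (- (2 * a + 1)) (a + 2^-1) (a + 1) (P' * P).
have -> : 2 * (a + 2^-1) + - (2 * a + 1) = 0 by field.
have -> : 2 * (a + 1) + - (2 * a + 1) = 1 by ring.
have -> : - 2 * (a + 2^-1) + (2 * a + 1) = 0 by field.
have -> : - 2 * a + (2 * a + 1) = 1 by ring.
have -> : pint 1 0 (Q' * Q) = - pint 0 1 (Q' * Q) by rewrite /pint opprB.
rewrite (mulrC P') (mulrC Q'); lra.
Qed.

Lemma L2inner_piece_neq P Q P' Q' k l : k != l ->
  L2inner (piece (halves P Q) k) (piece (halves P' Q') l) = 0.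
Proof.
wlog kl : P Q P' Q' k l / k < l => [hw|] kNl.
  case: (ltgtP k l) kNl => // kl _; first by rewrite hw // lt_eqF.
  by rewrite L2innerC hw // lt_eqF.
have kl1 : k%:~R + 1 <= l%:~R :> R.
  have -> : k%:~R + 1 = (k + 1)%:~R :> R by rewrite intrD.
  by rewrite ler_int lezD1.
rewrite !piece_halves.
rewrite L2innerDl; [|exact: L2_cell|exact: L2_cell|by apply: L2D; exact: L2_cell].
rewrite !(L2innerC _ (fun x => _ + _)) !L2innerDl; try exact: L2_cell.
by rewrite ![L2inner _ (cell k%:~R _ _)]L2innerC ![L2inner _ (cell (k%:~R + _) _ _)]L2innerC
  !L2inner_cell_disjoint ?addr0 //; lra.
Qed.

End Pieces.

(** * Continuous piecewise polynomials as combinations of bubbles and hats *)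

Section ContinuousPiecewisePolynomials.
Context {R : realType}.
Implicit Types (A B C D P Q p q : {poly R}) (k : int).

Lemma poly_vanishing_pm1 p : p.[1] = 0 -> p.[-1] = 0 ->
  exists2 s : {poly R}, p = (1 - 'X^2) * s & (size s <= (size p).-2)%N.
Proof.
move=> /rootP/factor_theorem[q1 E1] p1.
have /rootP/factor_theorem[q2 E2] : q1.[-1] = 0.
  move: p1; rewrite E1 !hornerE => /eqP; rewrite mulf_eq0 => /orP[/eqP //|].
  by rewrite -opprD oppr_eq0 paddr_eq0 // oner_eq0.
exists (- q2); first by rewrite E1 E2 polyCN; ring.
rewrite size_polyN E1 E2; have [->|q20] := eqVneq q2 0; first by rewrite size_poly0.
by rewrite !size_Mmonic ?monicXsubC ?mulf_neq0 ?polyXsubC_eq0 // !size_XsubC !addn2 /=.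
Qed.

Lemma comp_affine_size p (c d : R) : (size (p \Po (c *: 'X + d%:P)) <= size p)%N.
Proof.
have [->|p0] := eqVneq p 0; first by rewrite comp_poly0 size_poly0.
have : (size (c *: 'X + d%:P)%R <= 2)%N.
  by rewrite (leq_trans (size_polyD _ _)) // geq_max (leq_trans (size_scale_leq _ _)) ?size_polyX //
    (leq_trans (size_polyC_leq1 _)).
move=> h; rewrite (leq_trans (size_comp_poly_leq _ _)) //.
have p0' : (0 < size p)%N by rewrite lt0n size_poly_eq0.
have h' : ((size (c *: 'X + d%:P)%R).-1 <= 1)%N by rewrite -subn1 leq_subLR.
by rewrite -{2}(prednK p0') ltnS -[leqRHS]muln1 leq_mul.
Qed.

(** Dilation moves the knot in the middle of a cell to an integer: the halves of cell k become plain
    polynomials on the cells 2k and 2k + 1. *)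
Lemma piece_dilation P Q k :
  piece (halves P Q) k \o (fun x => x / 2) = (fun x =>
    piece (horner (Q \Po (- 2^-1 *: 'X + (2^-1)%:P))) (k + k) x +
    piece (horner (P \Po (2^-1 *: 'X + (2^-1)%:P))) (k + k + 1) x).
Proof.
apply/funext => x; rewrite /piece /halves /= !horner_comp !(hornerD, hornerZ, hornerX, hornerC).
rewrite !intrD; set a : R := k%:~R.
have -> : - (2 * (x / 2 - a) - 1) = - 2^-1 * (2 * (x - (a + a)) - 1) + 2^-1 by field.
have -> : 2 * (x / 2 - a) - 1 = 2^-1 * (2 * (x - (a + a + 1)) - 1) + 2^-1 by field.
have -> : (a <= x / 2 < a + 1) = (a + a <= x < a + a + 2).
  by apply/idP/idP => /andP[? ?]; apply/andP; split; lra.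
case: (ltP x (a + a + 1)) => xa.
  have -> : (x < a + a + 2) by lra.
  have -> : 2^-1 * (2 * (x - (a + a + 1)) - 1) + 2^-1 < 0 by lra.
  by rewrite /= addr0.
have -> : 2^-1 * (2 * (x - (a + a + 1)) - 1) + 2^-1 < 0 = false by lra.
have -> : a + a <= x by lra.
have -> : a + a + 1 + 1 = a + a + 2 by lra.
by rewrite /= add0r.
Qed.

Lemma piece_lin (u v : R -> R) (c : R) k x :
  piece (fun t => u t + c * v t) k x = piece u k x + c * piece v k x.
Proof. by rewrite /piece; case: ifP => // _; rewrite mulr0 addr0. Qed.

(** The polynomials [p] and [q] are the rising and the falling part of a hat. Its height is 2, not
    1, because r has the value of 1 + t at t = 1. *)
Variables (S : set (R -> R)) (M : nat) (p q : {poly R}).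
Hypothesis bubble : forall (s : {poly R}) k, (size s <= M)%N ->
  linear_span S (piece (horner ((1 - 'X^2) * s)) k).
Hypothesis hat : forall k,
  linear_span S (fun x => piece (horner p) k x + piece (horner q) (k + 1) x).
Hypotheses (pM : (size p <= M.+2)%N) (qM : (size q <= M.+2)%N).
Hypotheses (pl : p.[-1] = 0) (pr : p.[1] = 2) (ql : q.[-1] = 2) (qr : q.[1] = 0).

(* Interpolating the values of [P] at both ends by the halves of the hats
   leaves a polynomial vanishing at 1 and -1. *)
Lemma span_interior P k : (size P <= M.+2)%N ->
  linear_span S (fun x => piece (horner P) k x +
    (- (P.[-1] / 2)) * piece (horner q) k x + (- (P.[1] / 2)) * piece (horner p) k x).
Proof.
move=> PM; pose P' := P + (- (P.[-1] / 2)) *: q + (- (P.[1] / 2)) *: p.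
have [| |s P's sM] := @poly_vanishing_pm1 P'.
- by rewrite !hornerE pr qr; field.
- by rewrite !hornerE pl ql; field.
have sM' : (size s <= M)%N.
  rewrite (leq_trans sM) // -subn2 leq_subLR add2n.
  apply: leq_trans (size_polyD _ _) _; rewrite geq_max (leq_trans (size_scale_leq _ _)) // andbT.
  by apply: leq_trans (size_polyD _ _) _; rewrite geq_max PM (leq_trans (size_scale_leq _ _)).
apply: linear_span_ext (bubble k sM') _ => x; rewrite -P's.
rewrite -!piece_lin /piece; case: ifP => // _.
by rewrite !(hornerD, hornerZ).
Qed.

(** Each cell contributes its interior part from [span_interior]. By continuity the terms removed at
    a knot by the two adjacent cells combine into a multiple of one whole hat, and nothing is
    removed at the two outer ends. Four cells are what a generator supported on two cells occupies
    after dilation. *)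
Lemma span_four A B C D k :
  (size A <= M.+2)%N -> (size B <= M.+2)%N -> (size C <= M.+2)%N -> (size D <= M.+2)%N ->
  A.[-1] = 0 -> A.[1] = B.[-1] -> B.[1] = C.[-1] -> C.[1] = D.[-1] -> D.[1] = 0 ->
  linear_span S (fun x => piece (horner A) k x + piece (horner B) (k + 1) x +
    piece (horner C) (k + 2) x + piece (horner D) (k + 3) x).
Proof.
move=> sA sB sC sD A0 AB BC CD D1.
apply: linear_span_ext (linear_spanD (linear_spanD (linear_spanD (linear_spanD
  (linear_spanD (linear_spanD (span_interior k sA) (span_interior (k + 1) sB))
  (span_interior (k + 2) sC)) (span_interior (k + 3) sD))
  (linear_spanZ (A.[1] / 2) (hat k))) (linear_spanZ (B.[1] / 2) (hat (k + 1))))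
  (linear_spanZ (C.[1] / 2) (hat (k + 2)))) _ => x.
rewrite A0 D1 -AB -BC -CD (_ : k + 1 + 1 = k + 2) 1?(_ : k + 2 + 1 = k + 3) -?addrA //; ring.
Qed.

End ContinuousPiecewisePolynomials.

(** * Jacobi polynomials *)

Section OrthogonalPolynomials.
Context {R : realType}.
Implicit Types (p q om : {poly R}).

Definition monic_orthogonal om n p : Prop :=
  [/\ p \is monic, size p = n.+1 &
      forall q, (size q <= n)%N -> pint (-1) 1 (p * q * om) = 0].

(** The Gram matrix of 1, X, ..., X^(n-1) for the weight is positive definite, hence invertible, and
    the lower coefficients solve the resulting linear system. *)
Lemma monic_orthogonal_exists om n : (forall x, -1 < x < 1 -> 0 <= om.[x]) -> om != 0 ->
  exists p, monic_orthogonal om n p.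
Proof.
move=> om0 omN0.
pose ip p q := pint (-1) 1 (p * q * om).
have ip_suml (c : 'I_n -> R) q : ip (\sum_i c i *: 'X^i) q = \sum_i c i * ip 'X^i q.
  by rewrite /ip !mulr_suml pint_sum; apply: eq_bigr => i _; rewrite -!scalerAl pintZ.
pose G : 'M[R]_n := \matrix_(i, j) ip 'X^i 'X^j.
pose P (v : 'rV[R]_n) : {poly R} := \sum_i v 0 i *: 'X^i.
have PG v j : (v *m G) 0 j = ip (P v) 'X^j.
  by rewrite ip_suml mxE; apply: eq_bigr => i _; rewrite mxE.
have coefP v (i : 'I_n) : (P v)`_i = v 0 i.
  rewrite coef_sum (bigD1 i) //= coefZ coefXn eqxx mulr1 big1 ?addr0 // => j ji.
  by rewrite coefZ coefXn eq_sym (inj_eq val_inj) (negbTE ji) mulr0.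
have Gu : G \in unitmx.
  rewrite -row_free_unit; apply: inj_row_free => v vG0.
  suff P0 : P v = 0 by apply/rowP => i; rewrite -coefP P0 coef0 mxE.
  apply/eqP/negPn/negP => PN0.
  have : 0 < ip (P v) (P v).
    apply: pint_gt0 => [|x /om0 ?|]; first lra.
      by rewrite !hornerM mulr_ge0 // -expr2 sqr_ge0.
    by rewrite !mulf_neq0.
  rewrite ip_suml big1 ?ltxx // => i _.
  have := PG v i; rewrite vG0 mxE /ip [_ * P v]mulrC => <-; exact: mulr0.
pose b : 'rV[R]_n := \row_j - ip 'X^n 'X^j.
pose c := b *m invmx G.
have sP : (size (P c) <= n)%N.
  rewrite (leq_trans (size_sum _ _ _)) //; apply/bigmax_leqP => i _.
  by rewrite (leq_trans (size_scale_leq _ _)) // size_polyXn.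
have sX : (size (P c) < size ('X^n : {poly R}))%N by rewrite size_polyXn ltnS.
exists ('X^n + P c); split.
- by rewrite monicE lead_coefDl // lead_coefXn.
- by rewrite size_polyDl // size_polyXn.
move=> q sq; rewrite -[q]coefK poly_def mulr_sumr mulr_suml pint_sum.
rewrite big1 // => i _; rewrite -scalerAr -scalerAl pintZ.
have iN := leq_trans (ltn_ord i) sq.
have := PG c (Ordinal iN); rewrite mulmxKV // mxE /= /ip => E.
by rewrite mulrDl mulrDl pintD -E subrr mulr0.
Qed.

Lemma is_monic_jacobiP a b n p : is_monic_jacobi a%:R b%:R n p <->
  monic_orthogonal ((1 - 'X) ^+ a * (1 + 'X) ^+ b) n p.
Proof.
suff E q : \int[lebesgue_measure]_(x in `[-1, 1])
      (p.[x] * q.[x] * ((1 - x) `^ a%:R * (1 + x) `^ b%:R)) =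
    pint (-1) 1 (p * q * ((1 - 'X) ^+ a * (1 + 'X) ^+ b)).
  by split=> -[? ? h]; split=> // q /h; rewrite E.
rewrite -Rintegral_segment_poly; last lra.
apply: eq_Rintegral => x; rewrite inE /= in_itv /= => /andP[x1 x2].
rewrite !powR_mulrn; try lra.
by rewrite !hornerE.
Qed.

Lemma monic_jacobiP a b n :
  monic_orthogonal ((1 - 'X) ^+ a * (1 + 'X) ^+ b) n (monic_jacobi a%:R b%:R n).
Proof.
(* Once some polynomial with the property exists, [xget] returns one with the property and not its
   default value 0. *)
apply/is_monic_jacobiP; apply: (@xgetPex _ _ [set p | is_monic_jacobi a%:R b%:R n p]).
have [||p /is_monic_jacobiP ?] := @monic_orthogonal_exists ((1 - 'X) ^+ a * (1 + 'X) ^+ b) n; last by exists p.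
  move=> x /andP[x1 x2]; rewrite !hornerE.
  by rewrite mulr_ge0 // exprn_ge0 //; lra.
rewrite mulf_neq0 // expf_neq0 //.
  by rewrite -opprB oppr_eq0 polyXsubC_eq0.
by rewrite addrC -[1]opprK -polyCN polyXsubC_eq0.
Qed.

(** For lambda = 5/2 the weight is (1 - t^2)^2, the product of the factors 1 - t^2 of two functions
    [phi0]; this makes those functions orthogonal without weight. *)
Lemma ultrasphericalP n :
  monic_orthogonal ((1 - 'X^2) ^+ 2) n (monic_ultraspherical (5 / 2) n).
Proof.
rewrite /monic_ultraspherical (_ : 5 / 2 - 1 / 2 = 2%:R); last by field.
by rewrite (_ : 1 - 'X^2 = (1 - 'X) * (1 + 'X)) ?exprMn; [exact: monic_jacobiP | ring].
Qed.

Lemma monic_family_span (p_ : nat -> {poly R}) (M : nat) (s : {poly R}) :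
  (forall m, p_ m \is monic) -> (forall m, size (p_ m) = m.+1) -> (size s <= M)%N ->
  exists c : nat -> R, s = \sum_(m < M) c m *: p_ m.
Proof.
move=> mon siz; elim: M s => [|M IH] s sM.
  by exists (fun=> 0); move: sM; rewrite leqn0 size_poly_eq0 big_ord0 => /eqP.
have [|c Ec] := IH (s - s`_M *: p_ M).
  apply/leq_sizeP => j; rewrite leq_eqVlt coefB coefZ => /orP[/eqP <-|Mj].
    have := mon M; rewrite monicE lead_coefE siz => /eqP ->; ring.
  by rewrite (nth_default _ (leq_trans sM Mj)) [(p_ M)`_j]nth_default ?siz // mulr0 subr0.
exists (fun m => if m == M then s`_M else c m).
rewrite big_ord_recr /= eqxx -{1}[s](subrK (s`_M *: p_ M)) Ec; congr (_ + _).
by apply: eq_bigr => m _; rewrite ltn_eqF.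
Qed.

End OrthogonalPolynomials.

(** * The coefficients of w *)

Section Pochhammer.
Context {R : realType}.
Implicit Types (a : R) (i j k m n : nat).

Lemma pochhammerSr a j : pochhammer a j.+1 = pochhammer a j * (a + j%:R).
Proof. by rewrite /pochhammer big_ord_recr. Qed.

Lemma pochhammerSl a j : pochhammer a j.+1 = a * pochhammer (a + 1) j.
Proof.
rewrite /pochhammer big_ord_recl addr0; congr (_ * _); apply: eq_bigr => i _.
by rewrite -addrA -natr1 [1 + _]addrC.
Qed.

Lemma pochhammerD a i j : pochhammer a (i + j) = pochhammer a i * pochhammer (a + i%:R) j.
Proof.
rewrite /pochhammer big_split_ord; congr (_ * _); apply: eq_bigr => k _.
by rewrite /= natrD addrA.
Qed.

Lemma pochhammer_shift a k : pochhammer (a + 1) k * a = pochhammer a k * (a + k%:R).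
Proof. by rewrite -pochhammerSr pochhammerSl mulrC. Qed.

Lemma pochhammer_neq0 a j : (forall i, (i < j)%N -> a + i%:R != 0) -> pochhammer a j != 0.
Proof. by move=> h; apply/prodf_neq0 => i _; exact: h. Qed.

Lemma pochhammer_gt0 a j : 0 < a -> 0 < pochhammer a j.
Proof. by move=> a0; apply: prodr_gt0 => i _; rewrite ltr_wpDr. Qed.

Lemma pochhammer_natN N k : (k <= N)%N ->
  pochhammer (- N%:R : R) k * (N - k)`!%:R = (-1) ^+ k * N`!%:R.
Proof.
elim: k => [|k IH] kN; first by rewrite /pochhammer big_ord0 subn0 expr0 !mul1r.
have := IH (ltnW kN); rewrite pochhammerSr -(@subnSK k N) // factS natrM exprS.
move=> E; rewrite -mulrA [X in _ * X](_ : _ = - ((N - k.+1).+1%:R * (N - k.+1)`!%:R)).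
  by rewrite mulrN E mulN1r mulNr.
rewrite -natr1 natrB // -natr1; ring.
Qed.

Lemma pochhammer_natN_eq0 N k : (N < k)%N -> pochhammer (- N%:R : R) k = 0.
Proof.
by move=> Nk; rewrite /pochhammer (bigD1 (Ordinal Nk)) //= addNr mul0r.
Qed.

Lemma pochhammer_fact m j : pochhammer (m.+1%:R : R) j * m`!%:R = (m + j)`!%:R.
Proof.
elim: j => [|j IH]; first by rewrite /pochhammer big_ord0 mul1r addn0.
by rewrite pochhammerSr mulrAC IH addnS factS natrM mulrC -natrD addSn.
Qed.

Lemma prod_affine_pochhammer (c b : R) j :
  c != 0 -> \prod_(i < j) (c * i%:R + b) = c ^+ j * pochhammer (b / c) j.
Proof.
move=> c0; rewrite /pochhammer -[X in c ^+ X]card_ord -prodr_const -big_split /=.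
by apply: eq_bigr => i _; rewrite mulrDr mulrCA divff // mulr1 addrC.
Qed.

(** Such products are the denominators of residues at equally spaced poles. *)
Lemma prod_neq_fact k m : (k < m)%N ->
  \prod_(0 <= j < m | j != k) (j%:R - k%:R) = (-1) ^+ k * k`!%:R * (m - k.+1)`!%:R :> R.
Proof.
have base l : \prod_(0 <= j < l) (j%:R - l%:R) = (-1) ^+ l * l`!%:R :> R.
  have := @pochhammer_natN l l (leqnn l); rewrite subnn mulr1 => <-.
  by rewrite big_mkord; apply: eq_bigr => i _; rewrite addrC.
elim: m => // m IH; rewrite ltnS leq_eqVlt => /orP[/eqP ->|km].
  rewrite big_mkcond big_nat_recr //= eqxx /= mulr1 subnn mulr1 -base.
  by rewrite -big_mkcond; apply: congr_big_nat => // i /andP[_ im]; rewrite ltn_eqF.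
rewrite big_mkcond big_nat_recr //= -big_mkcond IH // gtn_eqF //=.
rewrite subSS -(subnSK km) factS natrM subnSK // natrB 1?ltnW //; ring.
Qed.

Lemma sum_odd m : \sum_(i < m) (2 * i%:R + 1) = m%:R ^+ 2 :> R.
Proof.
elim: m => [|m IH]; first by rewrite big_ord0 expr0n.
by rewrite big_ord_recr /= IH -natr1; ring.
Qed.

Lemma double_fact_odd m : (double_fact (2 * m + 1) * 2 ^ m * m`!)%N = (2 * m + 1)`!%N.
Proof.
elim: m => // m IH; rewrite (_ : (2 * m.+1 + 1 = (2 * m + 1).+2)%N); last lia.
rewrite !factS -IH /= expnS; lia.
Qed.

Lemma prod_odd m : \prod_(i < m) (2 * i%:R + 1) * (2 ^+ m * m`!%:R) = (2 * m)`!%:R :> R.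
Proof.
elim: m => [|m IH]; first by rewrite big_ord0 muln0 !mul1r.
rewrite big_ord_recr /= (_ : (2 * m.+1 = (2 * m).+2)%N); last lia.
rewrite !factS !natrM -IH exprS -!natr1 natrM; ring.
Qed.

End Pochhammer.

Section Hypergeometric.
Context {R : realType}.

Lemma series_finite_support (u : nat -> R) N : (forall i, (N < i)%N -> u i = 0) ->
  limn (series u) = \sum_(i < N.+1) u i.
Proof.
move=> u0; apply/cvg_lim => //; rewrite -(big_mkord xpredT).
apply: cvg_near_cst; exists N.+1 => // m /= Nm.
rewrite /series /= (@big_cat_nat _ _ _ N.+1 0 m) //= [X in _ + X]big_nat_cond.
by rewrite [X in _ + X]big1 ?addr0 // => i /andP[/andP[? _] _]; exact: u0.
Qed.

End Hypergeometric.

Section WCoefficients.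
Context {R : realType}.

Definition f_coef (m N k : nat) : R :=
  let M : R := m%:R in
  let N' : R := N%:R in
  (pochhammer (1 / 2 + 1) N * (N' ^+ 2 + (3 / 2 + 1) * N' + M + 1 + 1) *
      pochhammer (- M + 1 / 2) N) /
   (pochhammer (M + 1 + 1) N.+1 * (N.+1)`!%:R) *
  ((pochhammer (- N') k * (pochhammer (- N' ^+ 2 - (3 / 2 + 1) * N' - M - 1) k *
     (pochhammer (- M - 1 / 2) k * pochhammer (N' + 3 / 2 + 1) k))) /
   ((pochhammer (1 / 2 + 1) k * (pochhammer (- N' ^+ 2 - (3 / 2 + 1) * N' - M - 1 - 1) k *
     pochhammer (- M + 1 / 2) k)) * k`!%:R)).

(** The factor (-N)_k vanishes for k > N, so the hypergeometric series terminates. *)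
Lemma f_eps1E m N (t : R) :
  f_eps 1 m N t = \sum_(k < N.+1) f_coef m N k * t ^+ (2 * k + 1).
Proof.
rewrite /f_eps /hypergeometric (@series_finite_support _ _ N) => [|i Ni]; last first.
  by rewrite !big_cons pochhammer_natN_eq0 // !mul0r.
rewrite mulr_sumr; apply: eq_bigr => k _; rewrite !big_cons !big_nil !mulr1 /f_coef.
by rewrite [t ^+ (2 * k + 1)]exprD exprM !expr1; ring.
Qed.

Lemma half_integer_neq0 (a b : nat) : a%:R + 1 / 2 - b%:R != 0 :> R.
Proof.
apply/eqP => E; have : (2 * a + 1)%:R = (2 * b)%:R :> R.
  by rewrite natrD !natrM; lra.
by move/eqP; rewrite eqr_nat; lia.
Qed.

(** The residue condition at the pole -(2k + 2), for m = n - 1 and N = 2n - 1. On the left stand the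
    differences with the other even poles, then with the odd pole -(2n + 1); on the right the common
    moment, the differences with the nodes 1, 3, ..., 4n - 1, and the difference with the extra
    node. *)
Lemma f_coef_residue (m N k : nat) : N = (2 * m + 1)%N -> (k <= N)%N ->
  f_coef m N k * (2 ^+ N * ((-1) ^+ k * k`!%:R * (N - k)`!%:R)) * (N%:R - 2 * k%:R) =
  - (pochhammer (- m%:R - 1 / 2) N.+1 / pochhammer (m%:R + 1 + 1) N.+1 /
      ((N%:R + 1) * (2 * N%:R + 3))) *
    (2 ^+ N.+1 * pochhammer (k%:R + 3 / 2) N.+1) *
    (8 * (m%:R + 1) ^+ 2 + 4 * (m%:R + 1) - 1 - 2 * k%:R).
Proof.
move=> mN kN.
have EN : N%:R = 2 * m%:R + 1 :> R by rewrite mN natrD natrM.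
clear mN; rewrite /f_coef.
set M : R := m%:R in EN *; have M0 : 0 <= M by rewrite ler0n.
(* Two parameter pairs of the 4F3 differ by 1. The pair -A + 1 over -A leaves (A - k) / A, where 2
   (A - k) is the factor of the extra node; the pair -M - 1/2 over -M + 1/2 leaves a multiple of 1 /
   (M + 1/2 - k), the factor of the odd pole. *)
set A := 4 * M ^+ 2 + 10 * M + 11 / 2.
rewrite (_ : - N%:R ^+ 2 - (3 / 2 + 1) * N%:R - M - 1 = - A + 1); last by rewrite EN /A; field.
rewrite (_ : - A + 1 - 1 = - A); last ring.
rewrite (_ : N%:R ^+ 2 + (3 / 2 + 1) * N%:R + M + 1 + 1 = A); last by rewrite EN /A; field.
have r1 := pochhammer_shift (- A) k.
have r2 := pochhammer_shift (- M - 1 / 2) k.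
rewrite (_ : - M - 1 / 2 + 1 = - M + 1 / 2) in r2; last by field.
have r3 : pochhammer (1 / 2 + 1) N * (3 / 2 + N%:R) * pochhammer (N%:R + 3 / 2 + 1) k =
    pochhammer (1 / 2 + 1) k * pochhammer (k%:R + 3 / 2) N.+1 :> R.
  rewrite (_ : 3 / 2 = 1 / 2 + 1 :> R); last by field.
  rewrite -pochhammerSr (_ : N%:R + _ + 1 = 1 / 2 + 1 + N.+1%:R); last by rewrite -natr1; field.
  by rewrite -pochhammerD addnC pochhammerD [k%:R + _]addrC.
have r4 := @pochhammer_natN R N k kN.
have r5 := pochhammerSl (- M - 1 / 2) N.
rewrite (_ : - M - 1 / 2 + 1 = - M + 1 / 2) in r5; last by field.
rewrite r5.
rewrite factS natrM -[N.+1%:R in LHS]natr1 [2 ^+ N.+1]exprS.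
have h0 : (-1) ^+ k != 0 :> R by rewrite signr_eq0.
have h1 : A != 0 by rewrite /A; have := sqr_ge0 M; lra.
have h2 : 3 / 2 + N%:R != 0 :> R by rewrite EN; lra.
have h3 : M + 1 / 2 - k%:R != 0 := half_integer_neq0 m k.
have h4 : pochhammer (1 / 2 + 1) N != 0 :> R by rewrite gt_eqF // pochhammer_gt0; lra.
have h5 : pochhammer (1 / 2 + 1) k != 0 :> R by rewrite gt_eqF // pochhammer_gt0; lra.
have h6 : pochhammer (M + 1 + 1) N.+1 != 0 by rewrite gt_eqF // pochhammer_gt0; lra.
have h7 : pochhammer (- A) k != 0.
  apply: pochhammer_neq0 => i _.
  have := half_integer_neq0 (4 * m ^ 2 + 10 * m + 5) i.
  rewrite !natrD !natrM -/M; apply: contraNneq => E; rewrite /A in E; lra.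
have h8 : pochhammer (- M + 1 / 2) k != 0.
  apply: pochhammer_neq0 => i _.
  have := half_integer_neq0 i m; rewrite -/M; apply: contraNneq => E; lra.
have h9 : k`!%:R != 0 :> R by rewrite pnatr_eq0 -lt0n fact_gt0.
have h10 : N`!%:R != 0 :> R by rewrite pnatr_eq0 -lt0n fact_gt0.
have h11 : (N - k)`!%:R != 0 :> R by rewrite pnatr_eq0 -lt0n fact_gt0.
have h12 : N%:R + 1 != 0 :> R by rewrite EN; clear -M0; lra.
have h13 : 2 * N%:R + 3 != 0 :> R by rewrite EN; clear -M0; lra.

have {}r1 : pochhammer (- A + 1) k = pochhammer (- A) k * (A - k%:R) / A.
  by apply: (mulIf h1); rewrite divfK //; clear -r1; lra.
have {}r2 : pochhammer (- M - 1 / 2) k =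
    pochhammer (- M + 1 / 2) k * (M + 1 / 2) / (M + 1 / 2 - k%:R).
  by apply: (mulIf h3); rewrite divfK //; clear -r2; lra.
have {}r3 : pochhammer (N%:R + 3 / 2 + 1) k = pochhammer (1 / 2 + 1) k *
    pochhammer (k%:R + 3 / 2) N.+1 / (pochhammer (1 / 2 + 1) N * (3 / 2 + N%:R)) :> R.
  have h42 := mulf_neq0 h4 h2.
  by apply: (mulIf h42); rewrite divfK // -r3 mulrC.
have {}r4 : pochhammer (- N%:R) k = ((-1) ^+ k)^-1 * N`!%:R / (N - k)`!%:R :> R.
  by rewrite invr_sign -r4 mulfK.
rewrite r1 r2 r3 r4.
move: h0 h4 h5 h6 h7 h8 h9 h10 h11.
move: ((-1) ^+ k : R) (pochhammer (1 / 2 + 1) N) (pochhammer (1 / 2 + 1) k) (pochhammer (M + 1 + 1) N.+1)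
  (pochhammer (- A) k) (pochhammer (- M + 1 / 2) k) (k`!%:R : R) (N`!%:R : R) ((N - k)`!%:R : R)
  (pochhammer (k%:R + 3 / 2) N.+1) (pochhammer (- M + 1 / 2) N) (2 ^+ N : R).
move=> sg p3 y1 q y2 y3 kf Nf nf q3 pm tp h0 h4 h5 h6 h7 h8 h9 h10 h11.
rewrite EN in h2 h12 h13 *; rewrite /A in h1 *; rewrite -/M.
have M2 := sqr_ge0 M.
field; rewrite h0 h4 h5 h6 h7 h8 h9 h10 h11 /= andbT.
apply/and4P; split; [clear -M0; lra|clear -M0; lra| |clear -M0 M2; lra].
clear -h3; by apply: contraNneq h3 => E; apply/eqP; lra.
Qed.
End WCoefficients.

Section SparseMoments.
Context {R : realType}.

Lemma pint01_monomials d (c : 'I_d -> R) (e : 'I_d -> nat) s :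
  pint 0 1 ((\sum_k c k *: 'X^(e k)) * 'X^s) = \sum_k c k / (s%:R - - (e k + 1)%:R).
Proof.
rewrite mulr_suml pint_sum; apply: eq_bigr => k _.
rewrite -scalerAl -exprD pintZ pint01Xn; congr (_ / _).
by rewrite opprK -natrD addn1 addnS addnC.
Qed.

(** As the sum of the c_k is a value at 1, constant moments turn inner products into evaluations at
    1. *)
Lemma pint01_const_moments d (c : 'I_d -> R) (e : 'I_d -> nat) (P : {poly R}) mu :
  (forall k, pint 0 1 (P * 'X^(e k)) = mu) ->
  pint 0 1 (P * \sum_k c k *: 'X^(e k)) = (\sum_k c k) * mu.
Proof.
move=> h; rewrite mulr_sumr pint_sum mulr_suml; apply: eq_bigr => k _.
by rewrite -scalerAr pintZ h.
Qed.

Lemma prod_neq_fact2 k m : (k < m)%N ->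
  \prod_(0 <= j < m | j != k) (2 * j%:R - 2 * k%:R) =
    2 ^+ (m - 1) * ((-1) ^+ k * k`!%:R * (m - k.+1)`!%:R) :> R.
Proof.
move=> km; rewrite -prod_neq_fact //.
under eq_bigr do rewrite -mulrBr.
rewrite big_split /=; congr (_ * _).
have : \prod_(0 <= j < m) 2 = 2 ^+ m :> R by rewrite prodr_const_nat subn0.
have -> : 2 ^+ m = 2 * 2 ^+ (m - 1) :> R by rewrite -exprS; congr (_ ^+ _); lia.
by rewrite (bigD1_seq k) ?iota_uniq ?mem_index_iota //= => /(mulfI _) ->.
Qed.

End SparseMoments.

(** * Moments and norm of w *)

Section WPolynomial.
Context {R : realType} (n : nat) (hn : (0 < n)%N).

Lemma natr_odd k : (2 * k + 1)%:R = 2 * k%:R + 1 :> R.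
Proof. by rewrite natrD natrM. Qed.

Lemma natr_odd1 k : (2 * k + 1 + 1)%:R = 2 * k%:R + 2 :> R.
Proof. by rewrite natrD natr_odd; ring. Qed.

(** The value at s = 2n of the product of (s - (2i + 1)) / (s + 2i + 2) over i < 2n, the powers of 2
    being cancelled. *)
Definition rho : R := pochhammer (1 / 2 - n%:R) (2 * n) / pochhammer (n%:R + 1) (2 * n).

(** Forced by the coefficient -1 of X^(2n) through the residue at the pole -(2n + 1); there 2n (4n +
    1) is the difference with the extra node. *)
Definition w_moment : R := rho / (2 * n%:R * (4 * n%:R + 1)).

Definition w_poly : {poly R} :=
  \sum_(k < 2 * n) f_coef (n - 1) (2 * n - 1) k *: 'X^(2 * k + 1) - 'X^(2 * n).

Lemma w_halves : w n = halves w_poly (- w_poly) :> (R -> R).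
Proof.
apply/funext => t; rewrite /w /halves f_eps1E (_ : (2 * n - 1).+1 = (2 * n)%N); last lia.
have E x : w_poly.[x] =
    \sum_(k < 2 * n) f_coef (n - 1) (2 * n - 1) k * x ^+ (2 * k + 1) - x ^+ (2 * n).
  rewrite /w_poly hornerD hornerN hornerXn horner_sum; congr (_ - _).
  by apply: eq_bigr => k _; rewrite hornerZ hornerXn.
rewrite hornerN !E; case: ltP => t0.
  rewrite ltr0_norm // opprK -exprS (_ : (2 * n - 1).+1 = (2 * n)%N); last lia.
  have ev (x : R) j : (- x) ^+ (2 * j) = x ^+ (2 * j) by rewrite !exprM sqrrN.
  rewrite opprB ev -sumrN; congr (_ + _); apply: eq_bigr => k _.
  by rewrite [t ^+ _]exprD [(- t) ^+ _]exprD ev !expr1 !mulrN opprK.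
rewrite ger0_norm // mulNr -exprS (_ : (2 * n - 1).+1 = (2 * n)%N); last lia.
by rewrite addrC.
Qed.

Definition w_exp (k : nat) : nat := if (k < 2 * n)%N then (2 * k + 1)%N else (2 * n)%N.
Definition w_coef (k : nat) : R :=
  if (k < 2 * n)%N then f_coef (n - 1) (2 * n - 1) k else -1.
(* The last node is the one for which the nodes and the poles have the same
   sum, so that [w_poly] vanishes at 1. *)
Definition w_node (i : nat) : R :=
  if (i < 2 * n)%N then (2 * i + 1)%:R else - (8 * n%:R ^+ 2 + 4 * n%:R + 1).

Lemma w_polyE : w_poly = \sum_(k < (2 * n).+1) w_coef k *: 'X^(w_exp k).
Proof.
rewrite big_ord_recr /= /w_coef /w_exp ltnn scaleN1r; congr (_ - _).
by apply: eq_bigr => k _; rewrite ltn_ord.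
Qed.

Lemma w_exp_inj : injective (fun k : 'I_(2 * n).+1 => - (w_exp k + 1)%:R : R).
Proof.
move=> i j /oppr_inj /eqP; rewrite eqr_nat /w_exp => /eqP E; apply: val_inj => /=.
have := ltn_ord i; have := ltn_ord j; move: E; case: ltnP => ?; case: ltnP => ? ? ? ?; lia.
Qed.

Lemma w_pf : pf_spec (fun k : 'I_(2 * n).+1 => w_coef k)
  (fun k => - (w_exp k + 1)%:R) (fun i => w_node i) w_moment.
Proof.
apply: (pf_spec_residues w_exp_inj) => k.
have N1 : (2 * n = (2 * n - 1).+1)%N by lia.
have EN : (2 * n - 1)%:R = 2 * n%:R - 1 :> R by rewrite natrB ?natrM //; lia.
have Em : (n - 1)%:R = n%:R - 1 :> R by rewrite natrB.
have nodes (x : R) : \prod_(i < (2 * n).+1) (x - w_node i) =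
    2 ^+ (2 * n) * pochhammer ((1 - x) / 2) (2 * n) * (x + (8 * n%:R ^+ 2 + 4 * n%:R + 1)).
  rewrite big_ord_recr /= {2}/w_node ltnn opprK; congr (_ * _).
  have -> : 2 ^+ (2 * n) = (-2) ^+ (2 * n) :> R by rewrite !exprM sqrrN.
  have -> : (1 - x) / 2 = (x - 1) / -2 by field.
  rewrite -prod_affine_pochhammer ?oppr_eq0 ?pnatr_eq0 //.
  by apply: eq_bigr => i _; rewrite /w_node ltn_ord natrD natrM; ring.
rewrite {}nodes /w_moment /rho big_mkcond big_ord_recr /= -[ord_max == k](inj_eq val_inj) /=.
have := ltn_ord k; rewrite ltnS leq_eqVlt => /orP[/eqP kE|kn].
  rewrite kE eqxx mulr1 /w_coef /w_exp ltnn.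
  rewrite (eq_bigr (fun i : 'I_(2 * n) => 2 * i%:R + (1 - 2 * n%:R))); last first.
    by move=> i _; rewrite -(inj_eq val_inj) ltn_ord /= kE ltn_eqF ?ltn_ord //= !natr_odd1 ?natr_odd; ring.
  rewrite prod_affine_pochhammer ?pnatr_eq0 // natrD natrM.
  have -> : (1 - 2 * n%:R) / 2 = 1 / 2 - n%:R :> R by field.
  have -> : (1 - - (2 * n%:R + 1)) / 2 = n%:R + 1 :> R by field.
  have : pochhammer (n%:R + 1 : R) (2 * n) != 0 by rewrite gt_eqF // pochhammer_gt0 // ltr_wpDl.
  have n0 : 0 < n%:R :> R by rewrite ltr0n.
  move: (pochhammer _ _) (pochhammer _ _) (2 ^+ _ : R) => p q t q0.
  by field; rewrite q0 /=; clear -n0; apply/andP; split; lra.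
rewrite /(w_coef k) /(w_exp k) kn (gtn_eqF kn) /=.
rewrite (eq_bigr (fun i : 'I_(2 * n) => if i != k :> nat then 2 * i%:R - 2 * k%:R else 1)); last first.
  move=> i _; rewrite -(inj_eq val_inj) /w_exp ltn_ord /=; case: eqP => // _.
  by rewrite !natr_odd1; ring.
rewrite -big_mkcond -(big_mkord (fun j => j != k) (fun j => 2 * j%:R - 2 * k%:R)) prod_neq_fact2 //.
have Nk : (2 * n - k.+1 = 2 * n - 1 - k)%N by lia.
have kN : (k <= 2 * n - 1)%N by lia.
have Nm : (2 * n - 1 = 2 * (n - 1) + 1)%N by lia.
have := @f_coef_residue R _ _ _ Nm kN; rewrite -N1 Nk Em EN => E.
rewrite /w_exp ltnn natr_odd1 natr_odd mulrA.
have -> : (1 - - (2 * k%:R + 2)) / 2 = k%:R + 3 / 2 :> R by field.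
have -> : - (2 * k%:R + 2) - - (2 * n%:R + 1) = 2 * n%:R - 1 - 2 * k%:R :> R by ring.
rewrite E.
have -> : - (n%:R - 1) - 1 / 2 = 1 / 2 - n%:R :> R by field.
have -> : n%:R - 1 + 1 + 1 = n%:R + 1 :> R by ring.
have -> : (2 * n%:R - 1 + 1) * (2 * (2 * n%:R - 1) + 3) = 2 * n%:R * (4 * n%:R + 1) :> R by ring.
by rewrite [RHS]mulrA; congr (_ * _); ring.
Qed.

(* The ratio of the squared norm of [w] to its common odd moment. *)
Definition w_ratio : R := (2 * n%:R + 1) * rho.

Lemma w_node_sum :
  \sum_(i < (2 * n).+1) w_node i - \sum_(k < (2 * n).+1) (- (w_exp k + 1)%:R) = 0 :> R.
Proof.
have S1 : \sum_(i < 2 * n) w_node i = (2 * n)%:R ^+ 2.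
  by rewrite -sum_odd; apply: eq_bigr => i _; rewrite /w_node ltn_ord natr_odd.
have S2 : \sum_(i < 2 * n) - (w_exp i + 1)%:R = - ((2 * n)%:R ^+ 2 + (2 * n)%:R) :> R.
  rewrite -sum_odd -[X in _ + X%:R]card_ord -sumr_const -big_split -sumrN.
  by apply: eq_bigr => i _; rewrite /w_exp ltn_ord natr_odd1 /=; ring.
rewrite !big_ord_recr /= S1 S2 /w_node /w_exp ltnn natr_odd natrM; ring.
Qed.

Lemma w_coef_sum : \sum_(k < (2 * n).+1) w_coef k = 0.
Proof. by rewrite (pf_spec_sum _ w_pf) // w_node_sum mulr0. Qed.

Lemma w_poly1 : w_poly.[1] = 0.
Proof.
rewrite w_polyE horner_sum -[RHS]w_coef_sum; apply: eq_bigr => k _.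
by rewrite hornerZ hornerXn expr1n mulr1.
Qed.

Lemma w_poly_moment s : pint 0 1 (w_poly * 'X^s) =
  w_moment * (1 - \prod_(i < (2 * n).+1) ((s%:R - w_node i) / (s%:R - - (w_exp i + 1)%:R))).
Proof.
rewrite w_polyE pint01_monomials; apply: (pf_spec_value w_pf) => k.
by rewrite gt_eqF // (lt_le_trans (y := 0)) // oppr_lt0 ltr0n addn1.
Qed.

Lemma w_poly_odd_moment i : (i < 2 * n)%N -> pint 0 1 (w_poly * 'X^(2 * i + 1)) = w_moment.
Proof.
move=> i2n; rewrite w_poly_moment (bigD1 (widen_ord (leqnSn _) (Ordinal i2n))) //=.
by rewrite {1}/w_node i2n subrr !mul0r subr0 mulr1.
Qed.

Lemma w_poly_even_moment : pint 0 1 (w_poly * 'X^(2 * n)) = w_moment * (1 - w_ratio).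
Proof.
rewrite w_poly_moment; congr (_ * (1 - _)); rewrite big_ord_recr /= {2}/w_node {2}/w_exp ltnn.
have -> : \prod_(i < 2 * n) (((2 * n)%:R - w_node i) / ((2 * n)%:R - - (w_exp i + 1)%:R)) = rho.
  have P1 : \prod_(i < 2 * n) ((2 * n)%:R - w_node i) =
      2 ^+ (2 * n) * pochhammer (1 / 2 - n%:R) (2 * n).
    have -> : 2 ^+ (2 * n) = (-2) ^+ (2 * n) :> R by rewrite !exprM sqrrN.
    have -> : 1 / 2 - n%:R = (2 * n%:R - 1) / -2 :> R by field.
    rewrite -prod_affine_pochhammer ?oppr_eq0 ?pnatr_eq0 //.
    by apply: eq_bigr => i _; rewrite /w_node ltn_ord natr_odd natrM; ring.
  have P2 : \prod_(i < 2 * n) ((2 * n)%:R - - (w_exp i + 1)%:R) =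
      2 ^+ (2 * n) * pochhammer (n%:R + 1) (2 * n) :> R.
    have -> : n%:R + 1 = (2 * n%:R + 2) / 2 :> R by field.
    rewrite -prod_affine_pochhammer ?pnatr_eq0 //.
    by apply: eq_bigr => i _; rewrite /w_exp ltn_ord natr_odd1 natrM; ring.
  have t0 : 2 ^+ (2 * n) != 0 :> R by rewrite expf_neq0 // pnatr_eq0.
  by rewrite prodf_div P1 P2 -mulf_div divff // mul1r.
(* The factor of the last node and the last pole is (8n^2 + 6n + 1) / (4n + 1) = 2n + 1. *)
rewrite /w_ratio mulrC natr_odd natrM; congr (_ * _).
have n0 : 0 < n%:R :> R by rewrite ltr0n.
by field; lra.
Qed.

Lemma rho_neq0 : rho != 0.
Proof.
rewrite /rho mulf_neq0 ?invr_neq0 //.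
  apply: pochhammer_neq0 => i _; have := @half_integer_neq0 R i n.
  by rewrite (_ : i%:R + 1 / 2 - n%:R = 1 / 2 - n%:R + i%:R) //; field.
by rewrite gt_eqF // pochhammer_gt0 // ltr_wpDl.
Qed.

(** Because w(1) = 0 the odd coefficients add up to 1, so the odd terms contribute [w_moment]; the
    term -X^(2n) takes away [w_moment * (1 - w_ratio)]. *)
Lemma w_poly_sqr : pint 0 1 (w_poly * w_poly) = w_moment * w_ratio.
Proof.
rewrite {2}/w_poly mulrBr pintB w_poly_even_moment.
rewrite (@pint01_const_moments _ _ _ (fun k : 'I_(2 * n) => (2 * k + 1)%N) _ w_moment); last first.
  by move=> k; rewrite w_poly_odd_moment.
have := w_coef_sum; rewrite big_ord_recr /= {2}/w_coef ltnn => /eqP; rewrite subr_eq0 => /eqP.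
rewrite (eq_bigr (fun k : 'I_(2 * n) => f_coef (n - 1) (2 * n - 1) k)) => [->|k _]; last first.
  by rewrite /w_coef ltn_ord.
ring.
Qed.

(** The factor of w in [q_r] is thus <o, w> / |w|^2, the coefficient of the orthogonal projection
    onto w, since <o, w> is [w_moment]. *)
Lemma w_ratio_inv :
  ((-1) ^+ n * 2 ^+ (4 * n) * n`!%:R * (3 * n)`!%:R) / ((2 * n + 1)`!%:R * (2 * n)`!%:R) * w_ratio = 1 :> R.
Proof.
have E1 : pochhammer (n%:R + 1 : R) (2 * n) * n`!%:R = (3 * n)`!%:R.
  have -> : (3 * n = n + 2 * n)%N by lia.
  by rewrite natr1 pochhammer_fact.
have E2 : pochhammer (1 / 2 - n%:R : R) n = (-1) ^+ n * pochhammer (1 / 2) n.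
  rewrite /pochhammer -[X in (-1) ^+ X]card_ord -prodr_const -big_split /=.
  rewrite (reindex_inj rev_ord_inj); apply: eq_bigr => i _ /=.
  by rewrite natrB // -natr1; field.
have E3 : pochhammer (1 / 2 : R) n * 2 ^+ n * (2 ^+ n * n`!%:R) = (2 * n)`!%:R.
  rewrite -prod_odd; congr (_ * _).
  by rewrite -[1 / 2]mul1r mulrA mulr1 mulrC -prod_affine_pochhammer ?pnatr_eq0.
have E4 : pochhammer (1 / 2 - n%:R : R) (2 * n) = (-1) ^+ n * pochhammer (1 / 2) n ^+ 2.
  have -> : (2 * n = n + n)%N by lia.
  by rewrite pochhammerD E2 subrK -mulrA -expr2.
rewrite /w_ratio /rho E4 addn1 factS natrM -E3 -E1.
have -> : (2 * n).+1%:R = 2 * n%:R + 1 :> R by rewrite -addn1 natr_odd.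
have h1 : pochhammer (1 / 2 : R) n != 0 by rewrite gt_eqF // pochhammer_gt0; lra.
have h2 : pochhammer (n%:R + 1 : R) (2 * n) != 0 by rewrite gt_eqF // pochhammer_gt0 // ltr_wpDl.
have h3 : n`!%:R != 0 :> R by rewrite pnatr_eq0 -lt0n fact_gt0.
have h4 : 2 ^+ n != 0 :> R by rewrite expf_neq0 // pnatr_eq0.
have h5 : 2 * n%:R + 1 != 0 :> R by rewrite gt_eqF // ltr_wpDl // mulr_ge0.
have h6 : (-1) ^+ n != 0 :> R by rewrite signr_eq0.
rewrite -{1}[(-1) ^+ n]invr_sign [2 ^+ (4 * n)](_ : _ = (2 ^+ n) ^+ 4); last first.
  by rewrite -exprM; congr (_ ^+ _); lia.
move: (pochhammer _ _) (pochhammer _ _) (n`!%:R : R) (2 ^+ n : R) ((-1) ^+ n : R) h1 h2 h3 h4 h5 h6.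
move=> a b c d e h1 h2 h3 h4 h5 h6.
by field; rewrite h1 h2 h3 h4 h5 h6.
Qed.

End WPolynomial.

(** * The polynomial r and orthogonality *)

Section JacobiAtOne.
Context {R : realType}.

Lemma const_of_step (u : nat -> R) m : (forall i, (i < m)%N -> u i = u i.+1) ->
  forall i, (i <= m)%N -> u i = u 0%N.
Proof. by move=> h; elim=> // i IH im; rewrite -h // IH // ltnW. Qed.

Lemma sum_ord_coefX (p : {poly R}) m j : (size p <= m)%N ->
  p * 'X^j = \sum_(k < m) p`_k *: 'X^(k + j).
Proof.
move=> pm; rewrite -{1}[p]coefK poly_def mulr_suml (big_ord_widen m (fun k => p`_k *: 'X^k * 'X^j)) //.
rewrite big_mkcond; apply: eq_bigr => k _; case: ltnP => [_|pk]; first by rewrite -scalerAl exprD.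
by rewrite nth_default // scale0r.
Qed.

(* In the variable y = (1 + t) / 2, the function y p(2y - 1) has constant
   moments against y, ..., y^(m + 1). *)
Lemma monic_jacobi12_at1 m (p : {poly R}) :
  monic_orthogonal ((1 - 'X) ^+ 1 * (1 + 'X) ^+ 2) m p ->
  p.[1] * (2 * m + 3)`!%:R = 2 ^+ m * (m.+1)`!%:R * (m + 3)`!%:R.
Proof.
case=> pmon psize orth.
pose g := p \Po (2 *: 'X + (-1)%:P).
have s2 : size (2 *: 'X + (-1)%:P : {poly R}) = 2%N.
  have s1 : size (2 *: 'X : {poly R}) = 2%N by rewrite size_scale ?size_polyX ?pnatr_eq0.
  by rewrite size_polyDl s1 // ltnS size_polyC_leq1.
have gsize : size g = m.+1 by rewrite size_comp_poly2.
have gm : g`_m = 2 ^+ m.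
  have := @lead_coef_comp _ p (2 *: 'X + (-1)%:P); rewrite s2 => /(_ isT).
  rewrite (monicP pmon) mul1r psize /= lead_coefE gsize /= => ->; congr (_ ^+ _).
  by rewrite lead_coefE s2 coefD coefZ coefX coefC /= mulr1 addr0.
pose P := \sum_(k < m.+1) g`_k *: 'X^(k + 1).
have PE : P = g * 'X by rewrite -['X]expr1 (sum_ord_coefX _ (eq_leq gsize)).
pose mu := pint 0 1 (P * 'X^1).
have mom i : (i <= m)%N -> pint 0 1 (P * 'X^(i + 1)) = mu.
  apply: (@const_of_step (fun i => pint 0 1 (P * 'X^(i + 1)))) => {}i im.
  have sq : (size ((2^-1 *: 'X + (2^-1)%:P : {poly R}) ^+ i) <= m)%N.
    rewrite (leq_trans (size_poly_exp_leq _ _)) //.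
    have : (size (2^-1 *: 'X + (2^-1)%:P : {poly R})%R <= 2)%N.
      rewrite (leq_trans (size_polyD _ _)) // geq_max (leq_trans (size_scale_leq _ _)) ?size_polyX //.
      by rewrite (leq_trans (size_polyC_leq1 _)).
    by move: (size _) => t; nia.
  have := orth _ sq; have := pint_affine 2 (-1) 0 1
    (p * (2^-1 *: 'X + (2^-1)%:P) ^+ i * ((1 - 'X) ^+ 1 * (1 + 'X) ^+ 2)).
  rewrite (_ : 2 * 0 + -1 = -1); last by ring.
  rewrite (_ : 2 * 1 + -1 = 1); last by ring.
  move=> <- /eqP; rewrite mulf_eq0 pnatr_eq0 /= => /eqP E.
  apply/eqP; rewrite -subr_eq0 -pintB; apply/eqP.
  (* For t = 2y - 1 the weight (1 - t)(1 + t)^2 is 8 y^2 (1 - y); one factor y goes into P and one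
     into the test power. *)
  suff -> : P * 'X^(i + 1) - P * 'X^(i.+1 + 1) = 8^-1 *: ((p * (2^-1 *: 'X + (2^-1)%:P) ^+ i *
      ((1 - 'X) ^+ 1 * (1 + 'X) ^+ 2)) \Po (2 *: 'X + (-1)%:P)) by rewrite pintZ E mulr0.
  have half : 2^-1 *: (2 *: 'X + (-1)%:P) + (2^-1)%:P = 'X :> {poly R}.
    rewrite scalerDr scalerA mulVf ?pnatr_eq0 // scale1r -addrA -[(2^-1)%:P]alg_polyC.
    by rewrite polyCN scalerN addNr addr0.
  rewrite !comp_polyM !(rmorphXn (comp_poly _)) /= comp_polyB !comp_polyD comp_polyZ comp_polyX.
  rewrite !comp_polyC half -/g PE polyCN !scaler_nat -mul_polyC.
  set e := (8^-1)%:P; have e8 : e * 8 = 1.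
    by rewrite /e -[8 : {poly R}](rmorph_nat polyC 8) -polyCM mulVf ?pnatr_eq0.
  rewrite -[LHS]mul1r -{1}e8 !addn1 !exprS polyC1; ring.
pose y (k : 'I_m.+1) : R := - (k + 1 + 1)%:R.
pose s (i : 'I_m.+1) : R := (i + 1)%:R.
have pf : pf_spec (fun k : 'I_m.+1 => g`_k) y s mu.
  apply: pf_spec_values.
  - by move=> i j /eqP; rewrite eqr_nat => /eqP h; apply: val_inj => /=; lia.
  - move=> i k; rewrite gt_eqF // (lt_le_trans (y := 0)) ?ler0n // oppr_lt0 ltr0n; lia.
  - move=> i; have im : (i <= m)%N by rewrite -ltnS ltn_ord.
    by have <- := mom i im; rewrite pint01_monomials.
(* The sum of the coefficients expresses p(1) through mu, and the residue at the last pole, whose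
   coefficient is the leading one 2^m, gives mu. *)
have := pf_spec_sum (ltn0Sn m) pf; have := pf_spec_residue pf ord_max.
have -> : \sum_(k < m.+1) g`_k = p.[1].
  have <- : P.[1] = p.[1].
    by rewrite PE hornerMX mulr1 horner_comp !hornerE; congr _.[_]; ring.
  by rewrite horner_sum; apply: eq_bigr => k _; rewrite hornerZ hornerXn expr1n mulr1.
have -> : \sum_i s i - \sum_k y k = m.+1%:R * (m + 3)%:R.
  rewrite -sumrN -big_split /= (eq_bigr (fun i : 'I_m.+1 => (2 * i%:R + 1) + 2)) => [|i _].
    by rewrite big_split /= sum_odd sumr_const card_ord natrD -natr1; ring.
  by rewrite /s /y opprK !natrD; ring.
have -> : \prod_(j | j != ord_max) (y ord_max - y j) = (-1) ^+ m * m`!%:R.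
  rewrite big_mkcond big_ord_recr /= eqxx mulr1.
  have := @pochhammer_natN R m m (leqnn m); rewrite subnn mulr1 => <-.
  apply: eq_bigr => j _; rewrite -(inj_eq val_inj) /= ltn_eqF ?ltn_ord // /y /= !natrD; ring.
have -> : \prod_i (y ord_max - s i) = (-1) ^+ m.+1 * pochhammer (m + 2).+1%:R m.+1.
  rewrite /pochhammer -[X in (-1) ^+ X]card_ord -prodr_const -big_split /=.
  by apply: eq_bigr => i _; rewrite /y /s /= -!natr1 !natrD; ring.
rewrite /= gm exprS.
have := @pochhammer_fact R (m + 2) m.+1; rewrite (_ : (m + 2 + m.+1 = 2 * m + 3)%N); last lia.
move=> <- E ->; have E' : 2 ^+ m * m`!%:R = mu * pochhammer (m + 2).+1%:R m.+1.
  by apply: (mulfI (negbT (signr_eq0 R m))); rewrite mulrCA E; ring.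
rewrite factS natrM (_ : (m + 3)`! = (m + 3) * (m + 2)`!)%N; last by rewrite addnS factS.
rewrite natrM; transitivity (m.+1%:R * (m + 3)%:R * (m + 2)`!%:R * (mu * pochhammer (m + 2).+1%:R m.+1)).
  ring.
rewrite -E'; ring.
Qed.

End JacobiAtOne.

(** * Even and odd parts *)

Section Parity.
Context {R : realType}.
Implicit Types p s : {poly R}.

Definition reflect_poly p : {poly R} := p \Po - 'X.

Lemma reflect_polyE p t : (reflect_poly p).[t] = p.[- t].
Proof. by rewrite horner_comp hornerN hornerX. Qed.

Lemma reflect_polyK p : reflect_poly (reflect_poly p) = p.
Proof. by rewrite /reflect_poly -comp_polyA (rmorphN (comp_poly _)) /= comp_polyX opprK comp_polyXr. Qed.

Lemma reflect_polyM p s : reflect_poly (p * s) = reflect_poly p * reflect_poly s.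
Proof. exact: comp_polyM. Qed.

Lemma size_reflect_poly p : (size (reflect_poly p) <= size p)%N.
Proof. by rewrite /reflect_poly -scaleN1r -[_ *: _]addr0 comp_affine_size. Qed.

Lemma pint_sym p : pint (-1) 1 p = pint 0 1 p + pint 0 1 (reflect_poly p).
Proof.
rewrite (pint_split 0) addrC; congr (_ + _).
have := pint_affine (-1) 0 0 1 p; rewrite mulr0 mulr1 !addr0 mulN1r scaleN1r -/(reflect_poly p).
by rewrite /pint; lra.
Qed.

Definition even_part m p : {poly R} := \sum_(k < m.+1) p`_(2 * k) *: 'X^(2 * k).
Definition odd_part m p : {poly R} := \sum_(k < m) p`_(2 * k + 1) *: 'X^(2 * k + 1).

Lemma sum_parity (U : zmodType) (F : nat -> U) m :
  \sum_(j < (2 * m).+1) F j = \sum_(k < m.+1) F (2 * k)%N + \sum_(k < m) F (2 * k + 1)%N.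
Proof.
elim: m => [|m IH]; first by rewrite !big_ord_recr !big_ord0 /= addr0 muln0.
rewrite (_ : (2 * m.+1).+1 = (2 * m).+3)%N; last lia.
rewrite big_ord_recr big_ord_recr IH [in RHS]big_ord_recr [X in _ = _ + X]big_ord_recr /=.
rewrite (_ : (2 * m).+2 = (2 * m.+1)%N); last lia.
rewrite (_ : (2 * m).+1 = (2 * m + 1)%N); last lia.
rewrite -[LHS]addrA [RHS]addrACA; congr (_ + _); exact: addrC.
Qed.

Lemma parityE m p : (size p <= (2 * m).+1)%N -> p = even_part m p + odd_part m p.
Proof.
move=> pm; rewrite -(sum_parity (fun j => p`_j *: 'X^j)).
have := sum_ord_coefX 0 pm; rewrite expr0 mulr1 => {1}->.
by apply: eq_bigr => k _; rewrite addn0.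
Qed.

Lemma reflect_parity m p : (size p <= (2 * m).+1)%N ->
  reflect_poly p = even_part m p - odd_part m p.
Proof.
move=> pm; rewrite {1}(parityE pm) /reflect_poly comp_polyD; congr (_ + _).
  rewrite rmorph_sum; apply: eq_bigr => k _ /=.
  by rewrite comp_polyZ rmorphXn /= comp_polyX !exprM sqrrN.
rewrite rmorph_sum -sumrN; apply: eq_bigr => k _ /=.
by rewrite comp_polyZ rmorphXn /= comp_polyX exprD [X in _ = - (_ *: X)]exprD !exprM sqrrN !expr1 mulrN scalerN.
Qed.

Lemma horner1_even_odd m p : (size p <= (2 * m).+1)%N ->
  (even_part m p).[1] = (p.[1] + p.[-1]) / 2 /\ (odd_part m p).[1] = (p.[1] - p.[-1]) / 2.
Proof.
move=> pm; have -> : p.[1] = (even_part m p).[1] + (odd_part m p).[1].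
  by rewrite {1}(parityE pm) hornerD.
have -> : p.[-1] = (even_part m p).[1] - (odd_part m p).[1].
  by rewrite -reflect_polyE (reflect_parity pm) hornerD hornerN.
by split; field.
Qed.

Lemma horner1_sum d (c : 'I_d -> R) (e : 'I_d -> nat) :
  (\sum_k c k *: 'X^(e k)).[1] = \sum_k c k.
Proof. by rewrite horner_sum; apply: eq_bigr => k _; rewrite hornerZ hornerXn expr1n mulr1. Qed.

Lemma size_bubble M s : (size s <= M)%N -> (size ((1 - 'X^2) * s)%R <= M.+2)%N.
Proof.
move=> sM; rewrite (leq_trans (size_polyMleq _ _)) //.
have : (size (1 - 'X^2 : {poly R})%R <= 3)%N.
  by rewrite (leq_trans (size_polyD _ _)) // geq_max size_polyN size_polyXn size_poly1.
by move: sM; move: (size _) (size _) => a b; lia.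
Qed.

Lemma reflect_bubble (s : {poly R}) : reflect_poly ((1 - 'X^2) * s) = (1 - 'X^2) * reflect_poly s.
Proof. by rewrite reflect_polyM {1}/reflect_poly comp_polyB comp_polyC rmorphXn /= comp_polyX sqrrN. Qed.

Lemma reflectXn_even k : reflect_poly ('X^(2 * k) : {poly R}) = 'X^(2 * k).
Proof. by rewrite /reflect_poly rmorphXn /= comp_polyX !exprM sqrrN. Qed.

Lemma reflectXn_odd k : reflect_poly ('X^(2 * k + 1) : {poly R}) = - 'X^(2 * k + 1).
Proof. by rewrite exprD reflect_polyM reflectXn_even expr1 /reflect_poly comp_polyX mulrN. Qed.

End Parity.

Section WOrthogonality.
Context {R : realType} (n : nat) (hn : (0 < n)%N).
Implicit Types s : {poly R}.

Lemma w_poly_odd (s : {poly R}) : (size s <= (2 * (2 * n)).+1)%N ->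
  pint 0 1 (w_poly n * odd_part (2 * n) s) = (s.[1] - s.[-1]) / 2 * w_moment n.
Proof.
move=> ss; rewrite {1}/odd_part (@pint01_const_moments R _ _ (fun k : 'I_(2 * n) => (2 * k + 1)%N) _ (w_moment n)).
  rewrite -(horner1_sum _ (fun k : 'I_(2 * n) => (2 * k + 1)%N)) -/(odd_part (2 * n) s).
  by rewrite (horner1_even_odd ss).2.
by move=> k; rewrite w_poly_odd_moment.
Qed.

(** Against the odd function w only the odd part of (1 - X^2) s counts, and this part vanishes at
    1. *)
Lemma w_bubble (s : {poly R}) : (size s <= 4 * n - 1)%N ->
  pint 0 1 (w_poly n * ((1 - 'X^2) * s)) + pint 0 1 (- w_poly n * reflect_poly ((1 - 'X^2) * s)) = 0.
Proof.
move=> ss; set phi := (1 - 'X^2) * s.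
have sphi : (size phi <= (2 * (2 * n)).+1)%N.
  by rewrite (leq_trans (size_bubble ss)) //; lia.
rewrite -pintD (_ : _ + _ = 2 *: (w_poly n * odd_part (2 * n) phi)).
  have phi0 x : x ^+ 2 = 1 -> phi.[x] = 0.
    by move=> x2; rewrite hornerM hornerD hornerN hornerXn hornerC x2 subrr mul0r.
  by rewrite pintZ w_poly_odd // !phi0 ?sqrrN ?expr1n // subrr !mul0r mulr0.
by rewrite (reflect_parity sphi) {1}(parityE sphi) scaler_nat; ring.
Qed.

End WOrthogonality.

Section BoundaryPolynomial.
Context {R : realType} (n : nat) (hn : (0 < n)%N) (r : {poly R}).
(** Together these conditions characterise (I - P)(1 + t): degree at most 4n, the values of 1 + t at
    both ends, and orthogonality to the range of P. *)
Hypotheses (r_size : (size r <= (2 * (2 * n)).+1)%N) (r1 : r.[1] = 2) (rN1 : r.[-1] = 0).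
Hypothesis r_orth : forall s : {poly R}, (size s <= 4 * n - 1)%N ->
  pint (-1) 1 (r * ((1 - 'X^2) * s)) = 0.

Local Notation rE := (even_part (2 * n) r).
Local Notation rO := (odd_part (2 * n) r).
Local Notation n' := (n%:R : R).

Let rE1 : rE.[1] = 1.
Proof. by rewrite (horner1_even_odd r_size).1 r1 rN1; field. Qed.

Let rO1 : rO.[1] = 1.
Proof. by rewrite (horner1_even_odd r_size).2 r1 rN1; field. Qed.

Lemma orth_bubble (s : {poly R}) : (size s <= 4 * n - 1)%N ->
  pint 0 1 ((rE + rO) * ((1 - 'X^2) * s)) +
  pint 0 1 ((rE - rO) * reflect_poly ((1 - 'X^2) * s)) = 0.
Proof.
move=> /r_orth; rewrite pint_sym reflect_polyM -(parityE r_size).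
by rewrite (reflect_parity r_size).
Qed.

(** Testing r against (1 - X^2) X^(2j+1) equates consecutive odd moments. There are then as many
    nodes as poles, namely 2n, and o(1) = 1 equals the common moment times the node sum minus the
    pole sum, which is 2n (4n + 1). *)
Lemma odd_moment i : (i < 2 * n)%N ->
  pint 0 1 (rO * 'X^(2 * i + 1)) = (2 * n' * (4 * n' + 1))^-1.
Proof.
set mu := pint 0 1 (rO * 'X^(2 * 0 + 1)).
have mom j : (j < 2 * n)%N -> pint 0 1 (rO * 'X^(2 * j + 1)) = mu.
  move=> jn; have {}jn : (j <= 2 * n - 1)%N by lia.
  apply: (const_of_step (u := fun j => pint 0 1 (rO * 'X^(2 * j + 1))) _ jn) => {jn}j jn.
  have sX : (size ('X^(2 * j + 1) : {poly R}) <= 4 * n - 1)%N by rewrite size_polyXn; lia.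
  have := orth_bubble sX; rewrite reflect_bubble reflectXn_odd -pintD.
  rewrite (_ : _ + _ = 2 *: (rO * ((1 - 'X^2) * 'X^(2 * j + 1)))); last first.
    by rewrite scaler_nat; ring.
  rewrite pintZ => /eqP; rewrite mulf_eq0 pnatr_eq0 /= => /eqP E.
  have EX : 'X^(2 * j.+1 + 1) = 'X^(2 * j + 1) * 'X^2 :> {poly R} by rewrite -exprD; congr (_ ^+ _); lia.
  by apply/eqP; rewrite -subr_eq0 -pintB EX -{2}E; apply/eqP; congr (pint 0 1 _); ring.
move=> i2n; rewrite mom //.
pose y (k : 'I_(2 * n)) : R := - (2 * k + 1 + 1)%:R.
pose s (k : 'I_(2 * n)) : R := (2 * k + 1)%:R.
have pf : pf_spec (fun k : 'I_(2 * n) => r`_(2 * k + 1)) y s mu.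
  apply: pf_spec_values.
  - by move=> k l /eqP; rewrite eqr_nat => /eqP h; apply: val_inj => /=; lia.
  - move=> k l; rewrite gt_eqF // (lt_le_trans (y := 0)) ?ler0n // oppr_lt0 ltr0n; lia.
  - by move=> k; have <- := mom k (ltn_ord k); rewrite pint01_monomials.
have d0 : (0 < 2 * n)%N by lia.
have := pf_spec_sum d0 pf.
rewrite -(horner1_sum _ (fun k : 'I_(2 * n) => (2 * k + 1)%N)) -/(odd_part (2 * n) r) rO1.
have -> : \sum_k s k = (2 * n)%:R ^+ 2.
  by rewrite -sum_odd; apply: eq_bigr => k _; rewrite /s natr_odd.
have -> : \sum_k y k = - ((2 * n)%:R ^+ 2 + (2 * n)%:R).
  rewrite -sum_odd -[X in _ + X%:R]card_ord -sumr_const -big_split -sumrN.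
  by apply: eq_bigr => k _; rewrite /y natr_odd1 /=; ring.
rewrite natrM => E; have n0 : 0 < n' by rewrite ltr0n.
have nz : 2 * n' * (4 * n' + 1) != 0.
  by rewrite gt_eqF // !mulr_gt0 // ltr_wpDl // mulr_ge0 // ltW.
by apply: (mulIf nz); rewrite mulVf // [RHS]E; ring.
Qed.

(** The same argument with 2n + 1 nodes and poles, for which the difference of the sums is (2n +
    1)(4n + 1). *)
Lemma even_moment i : (i < (2 * n).+1)%N ->
  pint 0 1 (rE * 'X^(2 * i)) = ((2 * n' + 1) * (4 * n' + 1))^-1.
Proof.
set mu := pint 0 1 (rE * 'X^(2 * 0)).
have mom j : (j < (2 * n).+1)%N -> pint 0 1 (rE * 'X^(2 * j)) = mu.
  rewrite ltnS; apply: (const_of_step (u := fun j => pint 0 1 (rE * 'X^(2 * j)))) => {}j jn.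
  have sX : (size ('X^(2 * j) : {poly R}) <= 4 * n - 1)%N by rewrite size_polyXn; lia.
  have := orth_bubble sX; rewrite reflect_bubble reflectXn_even -pintD.
  rewrite (_ : _ + _ = 2 *: (rE * ((1 - 'X^2) * 'X^(2 * j)))); last first.
    by rewrite scaler_nat; ring.
  rewrite pintZ => /eqP; rewrite mulf_eq0 pnatr_eq0 /= => /eqP E.
  have EX : 'X^(2 * j.+1) = 'X^(2 * j) * 'X^2 :> {poly R} by rewrite -exprD; congr (_ ^+ _); lia.
  by apply/eqP; rewrite -subr_eq0 -pintB EX -{2}E; apply/eqP; congr (pint 0 1 _); ring.
move=> i2n; rewrite mom //.
pose y (k : 'I_(2 * n).+1) : R := - (2 * k + 1)%:R.
pose s (k : 'I_(2 * n).+1) : R := (2 * k)%:R.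
have pf : pf_spec (fun k : 'I_(2 * n).+1 => r`_(2 * k)) y s mu.
  apply: pf_spec_values.
  - by move=> k l /eqP; rewrite eqr_nat => /eqP h; apply: val_inj => /=; lia.
  - move=> k l; rewrite gt_eqF // (lt_le_trans (y := 0)) ?ler0n // oppr_lt0 ltr0n; lia.
  - by move=> k; have <- := mom k (ltn_ord k); rewrite pint01_monomials.
have := pf_spec_sum (ltn0Sn _) pf.
rewrite -(horner1_sum _ (fun k : 'I_(2 * n).+1 => (2 * k)%N)) -/(even_part (2 * n) r) rE1.
have S : \sum_(k < (2 * n).+1) (2 * k + 1)%:R = (2 * n).+1%:R ^+ 2 :> R.
  by rewrite -sum_odd; apply: eq_bigr => k _; rewrite natr_odd.
have -> : \sum_k y k = - ((2 * n).+1%:R ^+ 2) by rewrite -S -sumrN.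
have -> : \sum_k s k = (2 * n).+1%:R ^+ 2 - (2 * n).+1%:R.
  rewrite -S -[X in _ - X%:R]card_ord -sumr_const -sumrB.
  by apply: eq_bigr => k _; rewrite /s natrD addrK.
rewrite -natr1 natrM => E.
have nz : (2 * n' + 1) * (4 * n' + 1) != 0.
  by rewrite gt_eqF // mulr_gt0 // ltr_wpDl // mulr_ge0 // ler0n.
by apply: (mulIf nz); rewrite mulVf // [RHS]E; ring.
Qed.

Lemma odd_sqr : pint 0 1 (rO * rO) = (2 * n' * (4 * n' + 1))^-1.
Proof.
rewrite {2}/odd_part (@pint01_const_moments R _ _
  (fun k : 'I_(2 * n) => (2 * k + 1)%N) _ (2 * n' * (4 * n' + 1))^-1).
  by rewrite -(horner1_sum _ (fun k : 'I_(2 * n) => (2 * k + 1)%N)) -/(odd_part (2 * n) r) rO1 mul1r.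
by move=> k; rewrite odd_moment.
Qed.

Lemma even_sqr : pint 0 1 (rE * rE) = ((2 * n' + 1) * (4 * n' + 1))^-1.
Proof.
rewrite {2}/even_part (@pint01_const_moments R _ _
  (fun k : 'I_(2 * n).+1 => (2 * k)%N) _ ((2 * n' + 1) * (4 * n' + 1))^-1).
  by rewrite -(horner1_sum _ (fun k : 'I_(2 * n).+1 => (2 * k)%N)) -/(even_part (2 * n) r) rE1 mul1r.
by move=> k; rewrite even_moment.
Qed.

End BoundaryPolynomial.

Section GeneratorPolynomials.
Context {R : realType} (n : nat) (hn : (0 < n)%N) (r : {poly R}) (C : R).
Hypotheses (r_size : (size r <= (2 * (2 * n)).+1)%N) (r1 : r.[1] = 2) (rN1 : r.[-1] = 0).
Hypothesis r_orth : forall s : {poly R}, (size s <= 4 * n - 1)%N ->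
  pint (-1) 1 (r * ((1 - 'X^2) * s)) = 0.
Hypothesis C_ratio : C * w_ratio n = 1.

Local Notation rE := (even_part (2 * n) r).
Local Notation rO := (odd_part (2 * n) r).
Local Notation W := (w_poly n).
Local Notation n' := (n%:R : R).

(** For the actual r and C, [halves q_pos q_neg] is q_r, and exchanging the two polynomials gives
    q_l. *)
Definition q_pos : {poly R} := rE + (rO - C *: W).
Definition q_neg : {poly R} := rE - (rO - C *: W).

Let w_rO : pint 0 1 (W * rO) = w_moment n.
Proof. by rewrite w_poly_odd // r1 rN1; field. Qed.

(** Since C |w|^2 = <o, w>, the integral is |e|^2 - |o|^2 + C <o, w>. In C <o, w> the factor [rho]
    cancels, leaving 1 / (2n (2n + 1) (4n + 1)), exactly the gap between the two norms. *)
Lemma q_pos_neg : pint 0 1 (q_pos * q_neg) = 0.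
Proof.
rewrite /q_pos /q_neg.
have -> : (rE + (rO - C *: W)) * (rE - (rO - C *: W)) =
    rE * rE - rO * rO + (2 * C) *: (W * rO) - C ^+ 2 *: (W * W).
  by rewrite -!mul_polyC !rmorphM /=; ring.
rewrite pintB pintD pintB !pintZ even_sqr // odd_sqr // w_rO w_poly_sqr //.
have -> : C ^+ 2 * (w_moment n * w_ratio n) = C * w_moment n.
  by rewrite -[RHS]mulr1 -C_ratio; ring.
have n0 : 0 < n' by rewrite ltr0n.
have n1 : 2 * n' + 1 != 0 by rewrite gt_eqF // ltr_wpDl // mulr_ge0 // ltW.
have Crho : C * rho n = (2 * n' + 1)^-1.
  by apply: (mulIf n1); rewrite mulVf // -[RHS]C_ratio /w_ratio; ring.
have n2 : 4 * n' + 1 != 0 by rewrite gt_eqF // ltr_wpDl // mulr_ge0 // ltW.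
have n3 : n' != 0 by rewrite gt_eqF.
have -> : 2 * C * w_moment n = 2 * (C * w_moment n) by rewrite mulrA.
have -> : C * w_moment n = (2 * n' + 1)^-1 / (2 * n' * (4 * n' + 1)) by rewrite /w_moment mulrA Crho.
by field; rewrite n1 n2 n3.
Qed.

Let q_w_aux : pint 0 1 ((rO - C *: W) * W) = 0.
Proof.
rewrite mulrBl pintB -scalerAl pintZ w_poly_sqr // [rO * _]mulrC w_rO mulrCA C_ratio.
by rewrite mulr1 subrr.
Qed.

Lemma q_w : pint 0 1 (q_pos * W) + pint 0 1 (q_neg * - W) = 0.
Proof.
rewrite -pintD (_ : _ + _ = 2 *: ((rO - C *: W) * W)) ?pintZ ?q_w_aux ?mulr0 //.
by rewrite /q_pos /q_neg; move: (rO - C *: W) => D; rewrite scaler_nat; ring.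
Qed.

Lemma q_w_swap : pint 0 1 (q_neg * W) + pint 0 1 (q_pos * - W) = 0.
Proof. have := q_w; rewrite !mulrN !pintN => /eqP; rewrite subr_eq0 => /eqP ->; exact: subrr. Qed.

Lemma q_bubble (s : {poly R}) : (size s <= 4 * n - 1)%N ->
  pint 0 1 (q_pos * ((1 - 'X^2) * s)) + pint 0 1 (q_neg * reflect_poly ((1 - 'X^2) * s)) = 0.
Proof.
move=> ss; have := orth_bubble r_size r_orth ss; have := w_bubble hn ss.
set phi := (1 - 'X^2) * s => Ew Er.
have -> : q_pos * phi = (rE + rO) * phi + (- C) *: (W * phi).
  by rewrite /q_pos -!mul_polyC polyCN; ring.
have -> : q_neg * reflect_poly phi = (rE - rO) * reflect_poly phi + (- C) *: (- W * reflect_poly phi).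
  by rewrite /q_neg -!mul_polyC polyCN; ring.
by rewrite 2!pintD !pintZ addrACA Er add0r -mulrDr Ew mulr0.
Qed.

Lemma q_bubble_swap (s : {poly R}) : (size s <= 4 * n - 1)%N ->
  pint 0 1 (q_neg * ((1 - 'X^2) * s)) + pint 0 1 (q_pos * reflect_poly ((1 - 'X^2) * s)) = 0.
Proof.
move=> ss; rewrite addrC; have := @q_bubble (reflect_poly s).
rewrite -reflect_bubble reflect_polyK; apply.
by rewrite (leq_trans (size_reflect_poly _)).
Qed.

End GeneratorPolynomials.

(** * The translates of the generators *)

Section Generators.
Context {R : realType} (n : nat) (hn : (0 < n)%N).

Local Notation jac := (@monic_jacobi R 1 2 (4 * n - 1)).

Definition r_scale : R := (2 * (double_fact (8 * n + 1)%N)%:R) / ((4 * n + 2)`!)%N%:R.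

Definition r_poly : {poly R} := r_scale *: ((1 + 'X) * jac).

Definition w_scale : R :=
  ((-1) ^+ n * 2 ^+ (4 * n) * (n`!)%N%:R * ((3 * n)`!)%N%:R) /
      (((2 * n + 1)`!)%N%:R * ((2 * n)`!)%N%:R).

Let jacP : monic_orthogonal ((1 - 'X) ^+ 1 * (1 + 'X) ^+ 2) (4 * n - 1) jac.
Proof. exact: (monic_jacobiP 1 2 (4 * n - 1)). Qed.

Lemma r_poly_size : (size r_poly <= (2 * (2 * n)).+1)%N.
Proof.
rewrite (leq_trans (size_scale_leq _ _)) // (leq_trans (size_polyMleq _ _)) //.
have [_ -> _] := jacP; have : (size (1 + 'X : {poly R})%R <= 2)%N.
  by rewrite (leq_trans (size_polyD _ _)) // geq_max size_polyX size_poly1.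
by move: (size _) => a; lia.
Qed.

Lemma r_polyN1 : r_poly.[-1] = 0.
Proof. by rewrite hornerZ hornerM !(hornerD, hornerX, hornerC) subrr mul0r mulr0. Qed.

(** This is where the double factorial constant comes from: it scales the Jacobi polynomial so that
    r takes the value of 1 + t at 1. *)
Lemma r_poly1 : r_poly.[1] = 2.
Proof.
rewrite hornerZ hornerM !(hornerD, hornerX, hornerC) /r_scale.
have := monic_jacobi12_at1 jacP; have := double_fact_odd (4 * n).
rewrite (_ : (2 * (4 * n) + 1 = 8 * n + 1)%N); last lia.
rewrite (_ : (2 * (4 * n - 1) + 3 = 8 * n + 1)%N); last lia.
rewrite (_ : (4 * n - 1).+1 = (4 * n)%N); last lia.
rewrite (_ : (4 * n - 1 + 3 = 4 * n + 2)%N); last lia.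
move=> <-; rewrite !natrM natrX.
have -> : 2 ^+ (4 * n) = 2 * 2 ^+ (4 * n - 1) :> R by rewrite -exprS; congr (_ ^+ _); lia.
have h1 : (4 * n)`!%:R != 0 :> R by rewrite pnatr_eq0 -lt0n fact_gt0.
have h2 : (4 * n + 2)`!%:R != 0 :> R by rewrite pnatr_eq0 -lt0n fact_gt0.
have h3 : 2 ^+ (4 * n - 1) != 0 :> R by rewrite expf_neq0 // pnatr_eq0.
move: (jac.[1]) (double_fact _)%:R (_`!%:R : R) (_`!%:R : R) (2 ^+ _ : R) h1 h2 h3 => a d f g t h1 h2 h3.
move=> E; have E' : a * d * 2 = f by apply: (mulfI (mulf_neq0 h3 h1)); rewrite -E; ring.
rewrite (_ : 2 * d / f * ((1 + 1) * a) = 2 * (a * d * 2) / f); last by ring.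
by rewrite E' mulfK.
Qed.

(** The product (1 + t)(1 - t^2) is the Jacobi weight (1 - t)(1 + t)^2, hence the parameters 1 and
    2. *)
Lemma r_poly_orth (s : {poly R}) : (size s <= 4 * n - 1)%N ->
  pint (-1) 1 (r_poly * ((1 - 'X^2) * s)) = 0.
Proof.
have [_ _ orth] := jacP; move=> /orth E; rewrite -(mulr0 r_scale) -E -pintZ.
by congr (pint _ _ _); rewrite /r_poly -!mul_polyC; ring.
Qed.

Lemma w_scale_ratio : w_scale * w_ratio n = 1.
Proof. exact: w_ratio_inv. Qed.

Local Notation W := (w_poly n).
Local Notation qp := (q_pos n r_poly w_scale).
Local Notation qn := (q_neg n r_poly w_scale).
Local Notation rE := (even_part (2 * n) r_poly).
Local Notation rO := (odd_part (2 * n) r_poly).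

Lemma w_poly0 : W.[0] = 0 :> R.
Proof.
rewrite /w_poly hornerD hornerN hornerXn horner_sum expr0n (_ : (2 * n == 0)%N = false) ?subr0; last lia.
by rewrite big1 // => k _; rewrite hornerZ hornerXn addn1 exprS mul0r mulr0.
Qed.

Lemma horner_qp t : qp.[t] = rE.[t] + (rO.[t] - w_scale * W.[t]).
Proof. by rewrite /q_pos hornerD [(rO - _).[t]]hornerD [(- _).[t]]hornerN [(_ *: _).[t]]hornerZ. Qed.

Lemma horner_qn t : qn.[t] = rE.[t] - (rO.[t] - w_scale * W.[t]).
Proof.
by rewrite /q_neg hornerD hornerN [(rO - _).[t]]hornerD [(- (_ *: _)).[t]]hornerN [(_ *: _).[t]]hornerZ.
Qed.

Lemma q_rE : q_r n = halves qp qn :> (R -> R).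
Proof.
have E t : q_r n t = r_poly.[t] - w_scale * w n t.
  by rewrite /q_r -/r_scale -/w_scale hornerZ hornerM !(hornerD, hornerX, hornerC) mulrA.
apply/funext => t; rewrite E w_halves // /halves; case: ifP => _.
  have -> : r_poly.[t] = (rE - rO).[- t] by rewrite -(reflect_parity r_poly_size) reflect_polyE opprK.
  by rewrite horner_qn [(_ - _).[_]]hornerD [(- rO).[_]]hornerN [(- W).[_]]hornerN; ring.
by rewrite {1}(parityE r_poly_size) horner_qp hornerD; ring.
Qed.

(** Continuity at the midpoint of a cell. Reflection exchanges the halves, but [halves] assigns t =
    0 to the first polynomial in either case, so q_l needs this equality at 0. *)
Lemma q_at0 : qn.[0] = qp.[0].
Proof.
have rO0 : rO.[0] = 0.
  by rewrite horner_sum big1 // => k _; rewrite hornerZ hornerXn addn1 exprS mul0r mulr0.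
by rewrite horner_qp horner_qn w_poly0 rO0 mulr0 !subr0 addr0.
Qed.

Lemma q_lE : q_l n = halves qn qp :> (R -> R).
Proof.
apply/funext => t; rewrite /q_l q_rE /halves oppr_lt0 opprK.
by case: (ltrgtP t 0) => // ->; rewrite oppr0 q_at0.
Qed.

Lemma q_pos_at1 : qp.[1] = 2.
Proof.
have [E O] := horner1_even_odd r_poly_size.
by rewrite ?horner_qp ?horner_qn E O w_poly1 // r_poly1 r_polyN1; field.
Qed.

Lemma q_neg_at1 : qn.[1] = 0.
Proof.
have [E O] := horner1_even_odd r_poly_size.
by rewrite ?horner_qp ?horner_qn E O w_poly1 // r_poly1 r_polyN1; field.
Qed.

Definition bubble_poly (j : nat) : {poly R} :=
  (1 - 'X^2) * monic_ultraspherical (5 / 2) (j - 2).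

Lemma phi0E j : phi0 j = halves (bubble_poly j) (reflect_poly (bubble_poly j)) :> (R -> R).
Proof.
apply/funext => t; rewrite /halves reflect_polyE opprK if_same /phi0 hornerM.
by rewrite hornerD hornerN hornerXn hornerC.
Qed.

(* The translate of the [j]-th generator by [k] is the right piece on
   [k, k + 1[ plus the left piece on [k - 1, k[. *)
Definition right_pos (j : nat) : {poly R} :=
  match j with 0 => qn | 1 => W | _ => bubble_poly j end.
Definition right_neg (j : nat) : {poly R} :=
  match j with 0 => qp | 1 => - W | _ => reflect_poly (bubble_poly j) end.
Definition left_pos (j : nat) : {poly R} := if j is 0 then qp else 0.
Definition left_neg (j : nat) : {poly R} := if j is 0 then qn else 0.

Local Notation tr := (translates (@Phi4n R n)).

Lemma translatesE (i : 'I_(4 * n).+1) (k : int) : tr (i, k) = (fun x =>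
  piece (halves (right_pos i) (right_neg i)) k x +
  piece (halves (left_pos i) (left_neg i)) (k - 1) x).
Proof.
apply/funext => x; rewrite /translates /Phi4n /=; case: (i : nat) => [|j].
  rewrite /= -q_rE -q_lE /piece intrB; set a : R := k%:~R.
  rewrite (_ : 2 * (x - (a - 1)) - 1 = 2 * (x - a) + 1); last by ring.
  rewrite (_ : (a - 1 <= x < a - 1 + 1) = (-1 <= x - a < 0)); last first.
    by apply/idP/idP => /andP[? ?]; apply/andP; split; lra.
  rewrite (_ : (a <= x < a + 1) = (0 <= x - a < 1)); last first.
    by apply/idP/idP => /andP[? ?]; apply/andP; split; lra.
  case: ifP => [/andP[_ xa]|_]; last by rewrite addr0.
  by rewrite leNgt xa add0r.
have piece0 l : piece (halves 0 0) l x = 0 :> R.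
  by rewrite /piece /halves !horner0 !if_same.
rewrite /= piece0 addr0.
have -> : halves (right_pos j.+1) (right_neg j.+1) = if j is 0 then w n else phi0 j.+1.
  by case: j => [|j] /=; rewrite ?w_halves // phi0E.
rewrite /piece (_ : (k%:~R <= x < k%:~R + 1) = (0 <= x - k%:~R < 1)); last first.
  by apply/idP/idP => /andP[? ?]; apply/andP; split; lra.
by case: j.
Qed.

End Generators.

(** * The Gram matrix of the translates *)

Section Assembly.
Context {R : realType} (n : nat) (hn : (0 < n)%N).

Local Notation W := (w_poly n : {poly R}).
Local Notation qp := (q_pos n (r_poly n : {poly R}) (w_scale n)).
Local Notation qn := (q_neg n (r_poly n : {poly R}) (w_scale n)).
Local Notation Rp := (@right_pos R n).
Local Notation Rn := (@right_neg R n).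
Local Notation Lp := (@left_pos R n).
Local Notation Ln := (@left_neg R n).
Local Notation tr := (translates (@Phi4n R n)).

Definition halves_inner (P Q P' Q' : {poly R}) : R := pint 0 1 (P * P') + pint 0 1 (Q * Q').

Lemma halves_innerC P Q P' Q' : halves_inner P Q P' Q' = halves_inner P' Q' P Q.
Proof. by rewrite /halves_inner (mulrC P) (mulrC Q). Qed.

Lemma size_ultraspherical j : (2 <= j)%N -> (j <= 4 * n)%N ->
  (size (@monic_ultraspherical R (5 / 2) (j - 2)) <= 4 * n - 1)%N.
Proof. by move=> j2 jn; have [_ -> _] := @ultrasphericalP R (j - 2); lia. Qed.

Lemma bubble_bubble i j : (2 <= i)%N -> (i < j)%N ->
  halves_inner (bubble_poly i) (reflect_poly (bubble_poly i)) (bubble_poly j) (reflect_poly (bubble_poly j)) = 0.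
Proof.
move=> i2 ij; rewrite /halves_inner -reflect_polyM -pint_sym.
have [_ _ orth] := @ultrasphericalP R (j - 2).
have /orth E : (size (@monic_ultraspherical R (5 / 2) (i - 2)) <= j - 2)%N.
  by have [_ -> _] := @ultrasphericalP R (i - 2); lia.
by rewrite -[RHS]E /bubble_poly; congr (pint _ _ _); ring.
Qed.

Lemma right_orthogonal i j : (i < j)%N -> (j <= 4 * n)%N ->
  halves_inner (Rp i) (Rn i) (Rp j) (Rn j) = 0.
Proof.
have rs := @r_poly_size R n hn; have r1 := @r_poly1 R n hn; have rN1 := @r_polyN1 R n.
have ro := @r_poly_orth R n; have ws := @w_scale_ratio R n hn.
case: i => [|[|i]]; case: j => [|[|j]] // ij jn.
- exact: (q_w_swap hn rs r1 rN1 ws).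
- exact: (q_bubble_swap hn _ rs ro (size_ultraspherical (ltn0Sn _ : (1 < _.+2)%N) jn)).
- exact: (w_bubble hn (size_ultraspherical (ltn0Sn _ : (1 < _.+2)%N) jn)).
- exact: bubble_bubble.
Qed.

Lemma left_orthogonal i j : (i < j)%N -> halves_inner (Lp i) (Ln i) (Lp j) (Ln j) = 0.
Proof. by case: j => // j _; rewrite /halves_inner /left_pos /left_neg !mulr0 pint0 addr0. Qed.

(** Cell k carries the right pieces of the translates by k and, from the translate by k + 1, the
    rising half of the two-cell generator. The latter must be orthogonal to all the former, in
    particular q_r to q_l. *)
Lemma right_left_orthogonal i j : (i <= 4 * n)%N -> halves_inner (Rp i) (Rn i) (Lp j) (Ln j) = 0.
Proof.
have rs := @r_poly_size R n hn; have r1 := @r_poly1 R n hn; have rN1 := @r_polyN1 R n.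
have ro := @r_poly_orth R n; have ws := @w_scale_ratio R n hn.
case: j => [|j]; last by rewrite /halves_inner /left_pos /left_neg !mulr0 pint0 addr0.
rewrite halves_innerC; case: i => [|[|i]] jn /=.
- by rewrite /halves_inner [qn * qp]mulrC (q_pos_neg hn rs r1 rN1 ro ws) addr0.
- exact: (q_w hn rs r1 rN1 ws).
- exact: (q_bubble hn _ rs ro (size_ultraspherical (ltn0Sn _ : (1 < _.+2)%N) jn)).
Qed.

Lemma L2inner_piece_if (P Q P' Q' : {poly R}) (k l : int) :
  L2inner (piece (halves P Q) k) (piece (halves P' Q') l) =
  if k == l then halves_inner P Q P' Q' / 2 else 0.
Proof. by case: eqVneq => [->|kl]; [exact: L2inner_piece|exact: L2inner_piece_neq]. Qed.

Lemma L2_translates ik : L2 (tr ik).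
Proof. by case: ik => i k; rewrite translatesE //; apply: L2D; exact: L2_piece. Qed.

(** Of the four products of pieces the two mixed ones vanish by [right_left_orthogonal], and the
    others live on a common cell only if k = l. *)
Lemma inner_translates (i j : 'I_(4 * n).+1) k l :
  L2inner (tr (i, k)) (tr (j, l)) =
  if k == l then (halves_inner (Rp i) (Rn i) (Rp j) (Rn j) +
    halves_inner (Lp i) (Ln i) (Lp j) (Ln j)) / 2 else 0.
Proof.
rewrite !translatesE // L2innerDl; [|exact: L2_piece|exact: L2_piece|by apply: L2D; exact: L2_piece].
rewrite !(L2innerC _ (fun x => _ + _)) !L2innerDl; try exact: L2_piece.
have im : (i <= 4 * n)%N by rewrite -ltnS ltn_ord.
have jm : (j <= 4 * n)%N by rewrite -ltnS ltn_ord.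
rewrite !L2inner_piece_if [halves_inner (Lp j) _ _ _]halves_innerC.
rewrite !right_left_orthogonal // mul0r !if_same addr0 add0r (inj_eq (addIr _)) eq_sym.
rewrite halves_innerC [halves_inner (Lp j) _ _ _]halves_innerC; case: ifP => _; last by rewrite addr0.
exact: (esym (mulrDl _ _ _)).
Qed.

Lemma inner_translates_neq ik jl : ik != jl -> L2inner (tr ik) (tr jl) = 0.
Proof.
case: ik jl => i k [j l]; rewrite inner_translates xpair_eqE; case: (k == l) => //; rewrite andbT.
wlog ij : i j / (i < j)%N => [hw|_].
  move=> ij; case: (ltngtP i j) => [lt_ij|lt_ji|/val_inj E]; first exact: hw.
    by rewrite halves_innerC [halves_inner (Lp i) _ _ _]halves_innerC hw // eq_sym.
  by rewrite E eqxx in ij.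
by rewrite right_orthogonal ?left_orthogonal ?addr0 ?mul0r // -ltnS.
Qed.

Lemma pint_sqr_ge0 (P : {poly R}) : 0 <= pint 0 1 (P * P).
Proof. by apply: pint_ge0 => // x _; rewrite hornerM -expr2 sqr_ge0. Qed.

Lemma pint_sqr_gt0 (P : {poly R}) : P != 0 -> 0 < pint 0 1 (P * P).
Proof.
move=> P0; apply: pint_gt0 => // [x _|]; first by rewrite hornerM -expr2 sqr_ge0.
by rewrite mulf_neq0.
Qed.

Lemma w_poly_neq0 : W != 0.
Proof.
have n0 : 0 < n%:R :> R by rewrite ltr0n.
have h : rho n != 0 :> R by exact: rho_neq0.
have wm : w_moment n != 0 :> R.
  have n1 : 0 < 2 * n%:R :> R by rewrite mulr_gt0.
  have n2 : 0 < 4 * n%:R + 1 :> R by rewrite ltr_wpDl // mulr_ge0 // ltW.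
  apply: mulf_neq0 => //; apply: invr_neq0; rewrite gt_eqF //; exact: mulr_gt0.
have wr : w_ratio n != 0 :> R.
  by rewrite /w_ratio mulf_neq0 // gt_eqF // ltr_wpDl // mulr_ge0 // ltW.
apply/eqP => W0; have := mulf_neq0 wm wr.
by rewrite -(@w_poly_sqr R n hn) W0 mul0r pint0 eqxx.
Qed.

Definition sqnorm i : R :=
  (halves_inner (Rp i) (Rn i) (Rp i) (Rn i) + halves_inner (Lp i) (Ln i) (Lp i) (Ln i)) / 2.

Lemma sqnorm_gt0 i : 0 < sqnorm i.
Proof.
have ge P Q : 0 <= halves_inner P Q P Q by rewrite addr_ge0 // pint_sqr_ge0.
have gt P Q : P != 0 -> 0 < halves_inner P Q P Q by move=> ?; rewrite ltr_pwDl ?pint_sqr_gt0 // pint_sqr_ge0.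
rewrite divr_gt0 //; case: i => [|[|i]].
- rewrite ltr_wpDl // gt //=; apply: contra_eq_neq (@q_pos_at1 R n hn) => ->.
  by rewrite horner0 eq_sym pnatr_eq0.
- by rewrite ltr_pwDl // gt //= w_poly_neq0.
- rewrite ltr_pwDl // gt //= mulf_neq0 //.
    apply/eqP => /(congr1 (fun p : {poly R} => p.[0])).
    by rewrite hornerD hornerN hornerXn hornerC expr0n subr0 horner0 => /eqP; rewrite oner_eq0.
  by have [/monic_neq0] := @ultrasphericalP R (i.+2 - 2).
Qed.

End Assembly.

(** * The two-scale relation of the generators *)

Section Refinement4n.
Context {R : realType} (n : nat) (hn : (0 < n)%N).

Local Notation W := (w_poly n : {poly R}).
Local Notation r := (r_poly n : {poly R}).
Local Notation qp := (q_pos n r (w_scale n)).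
Local Notation qn := (q_neg n r (w_scale n)).
Local Notation Rp := (@right_pos R n).
Local Notation Rn := (@right_neg R n).
Local Notation Lp := (@left_pos R n).
Local Notation Ln := (@left_neg R n).
Local Notation tr := (translates (@Phi4n R n)).
Local Notation S := (range tr).

Lemma piece_right_in_span j k : (0 < j)%N -> (j <= 4 * n)%N ->
  linear_span S (piece (halves (Rp j) (Rn j)) k).
Proof.
move=> j0 jn; apply: linear_span_mem; have jn' : (j < (4 * n).+1)%N by [].
exists (Ordinal jn', k) => //; rewrite translatesE //=; apply/funext => x.
case: j j0 {jn jn'} => // j _; rewrite /left_pos /left_neg.
by rewrite {2}/piece /halves !horner0 !if_same addr0.
Qed.

(** The ultraspherical polynomials of degrees 0, ..., 4n - 2 span all admissible cofactors s. *)
Lemma bubble_in_span (s : {poly R}) k : (size s <= 4 * n - 1)%N ->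
  linear_span S (piece (horner ((1 - 'X^2) * s)) k).
Proof.
move=> ss; have [m|m|c sE] := @monic_family_span R (fun m => monic_ultraspherical (5 / 2) m) _ s _ _ ss.
- by have [] := @ultrasphericalP R m.
- by have [] := @ultrasphericalP R m.
apply: (linear_span_ext (f := fun x => \sum_(m < 4 * n - 1) c m *
    piece (halves (Rp m.+2) (Rn m.+2)) k x)) => [|x].
  apply: (@linear_span_sum _ _ _ _ (fun (m : 'I_(4 * n - 1)) x =>
    c m * piece (halves (Rp m.+2) (Rn m.+2)) k x)) => m.
  by apply/linear_spanZ/piece_right_in_span => //; have := ltn_ord m; lia.
rewrite /piece; case: ifP => _; last by rewrite big1 // => m _; rewrite mulr0.
rewrite hornerM sE horner_sum mulr_sumr; apply: eq_bigr => m _.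
have m2 : (m.+2 - 2 = m)%N by rewrite subn2.
by rewrite -phi0E /phi0 m2 hornerZ hornerD hornerN hornerXn hornerC; ring.
Qed.

(** Adding back on each cell the multiple of w that was subtracted turns the first generator into
    the hat made of r and its reflection; the sign on the second cell is opposite because w is
    odd. *)
Lemma hat_in_span k : linear_span S
  (fun x => piece (horner r) k x + piece (horner (reflect_poly r)) (k + 1) x).
Proof.
have t0 : linear_span S (tr (ord0, k + 1)) by apply: linear_span_mem; exists (ord0, k + 1).
have w_span l : linear_span S (piece (halves W (- W)) l).
  by apply: (@piece_right_in_span 1) => //; lia.
have := linear_spanD (linear_spanD t0 (linear_spanZ (w_scale n) (w_span k)))
  (linear_spanZ (- w_scale n) (w_span (k + 1))).
move/linear_span_ext; apply => x; rewrite translatesE //= addrK.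
rewrite /right_pos /right_neg /left_pos /left_neg /=.
have rE t : r.[t] = halves qp qn t + w_scale n * halves W (- W) t.
  by rewrite -q_rE // -w_halves // /q_r -/(r_scale n) -/(w_scale n) hornerZ hornerM
    !(hornerD, hornerX, hornerC) mulrA subrK.
have rE' t : (reflect_poly r).[t] = halves qn qp t - w_scale n * halves W (- W) t.
  rewrite reflect_polyE rE -q_rE // -q_lE // /q_l; congr (_ + _); rewrite -mulrN; congr (_ * _).
  rewrite /halves oppr_lt0 opprK [(- W).[_]]hornerN [(- W).[_]]hornerN.
  (* At t = 0 both sides evaluate the first polynomial of [halves], and oddness of w there rests on
     W(0) = 0. *)
  by case: (ltrgtP t 0) => [_|_|->]; rewrite ?opprK ?oppr0 ?w_poly0 ?oppr0.
rewrite /piece; case: ifP => _; case: ifP => _; rewrite ?rE ?rE' ?mulr0 ?addr0 ?add0r //; ring.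
Qed.

Lemma size_sparse M d (c : 'I_d -> R) (e : 'I_d -> nat) : (forall k, e k < M)%N ->
  (size (\sum_k c k *: 'X^(e k) : {poly R})%R <= M)%N.
Proof.
move=> eM; rewrite (leq_trans (size_sum _ _ _)) //; apply/bigmax_leqP => k _.
by rewrite (leq_trans (size_scale_leq _ _)) // size_polyXn.
Qed.

Lemma size_addM M (p q : {poly R}) : (size p <= M)%N -> (size q <= M)%N -> (size (p + q)%R <= M)%N.
Proof. by move=> pM qM; rewrite (leq_trans (size_polyD _ _)) // geq_max pM. Qed.

Lemma w_poly_size : (size W <= (4 * n - 1).+2)%N.
Proof.
apply: size_addM; last by rewrite size_polyN size_polyXn; lia.
by apply: size_sparse => k; have := ltn_ord k; lia.
Qed.

Lemma q_size : (size qp <= (4 * n - 1).+2)%N /\ (size qn <= (4 * n - 1).+2)%N.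
Proof.
have sE : (size (even_part (2 * n) r) <= (4 * n - 1).+2)%N.
  by apply: size_sparse => k; have := ltn_ord k; lia.
have sD : (size (odd_part (2 * n) r - w_scale n *: W)%R <= (4 * n - 1).+2)%N.
  apply: size_addM; first by apply: size_sparse => k; have := ltn_ord k; lia.
  by rewrite size_polyN (leq_trans (size_scale_leq _ _)) // w_poly_size.
by split; apply: size_addM; rewrite ?size_polyN.
Qed.

Lemma right_size j : (j <= 4 * n)%N ->
  (size (Rp j) <= (4 * n - 1).+2)%N /\ (size (Rn j) <= (4 * n - 1).+2)%N.
Proof.
have [sp sn] := q_size; case: j => [|[|j]] jn //=.
  by rewrite size_polyN w_poly_size.
have sb : (size (bubble_poly j.+2 : {poly R}) <= (4 * n - 1).+2)%N.
  by apply/size_bubble/size_ultraspherical.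
by rewrite (leq_trans (size_reflect_poly _)).
Qed.

Lemma left_size j : (size (Lp j) <= (4 * n - 1).+2)%N /\ (size (Ln j) <= (4 * n - 1).+2)%N.
Proof. by have := q_size; case: j => [|j] //=; rewrite size_poly0. Qed.

Lemma bubble_poly_pm1 j (x : R) : x ^+ 2 = 1 -> (bubble_poly j).[x] = 0.
Proof. by move=> x2; rewrite hornerM hornerD hornerN hornerXn hornerC x2 subrr mul0r. Qed.

(** Continuity of a generator at -1, -1/2, 0, 1/2 and 1, read off its four half cells; after
    dilation these are the gluing conditions of [span_four]. *)
Lemma halves_match j : [/\ (Ln j).[1] = 0, (Ln j).[0] = (Lp j).[0], (Lp j).[1] = (Rn j).[1],
  (Rn j).[0] = (Rp j).[0] & (Rp j).[1] = 0].
Proof.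
have q1 := @q_neg_at1 R n hn; have q_at0 := @q_at0 R n hn.
case: j => [|[|j]] /=; rewrite ?horner0; split=> //.
- by rewrite [RHS]hornerN w_poly1 // oppr0.
- by rewrite [LHS]hornerN w_poly0 // oppr0.
- exact: w_poly1.
- by rewrite reflect_polyE bubble_poly_pm1 // sqrrN expr1n.
- by rewrite reflect_polyE oppr0.
- by rewrite bubble_poly_pm1 // expr1n.
Qed.

Lemma Phi4n_refinable (i : 'I_(4 * n).+1) : linear_span S (fun x => @Phi4n R n i (x / 2)).
Proof.
have im : (i <= 4 * n)%N by rewrite -ltnS ltn_ord.
have [sRp sRn] := right_size im; have [sLp sLn] := left_size i.
have [m1 m2 m3 m4 m5] := halves_match i.
have sr : (size r <= (4 * n - 1).+2)%N by rewrite (leq_trans (r_poly_size _)) //; lia.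
have sr' : (size (reflect_poly r) <= (4 * n - 1).+2)%N by rewrite (leq_trans (size_reflect_poly _)).
have rl := @r_polyN1 R n; have rr := @r_poly1 R n hn.
have r'l : (reflect_poly r).[-1] = 2 by rewrite reflect_polyE opprK.
have r'r : (reflect_poly r).[1] = 0 by rewrite reflect_polyE.
(* The changes of variable of [piece_dilation]: [dn] undoes the reflection of a left half, [up]
   serves a right half. The dilated generator lives on [-2, 2], that is, on the four cells starting
   at -2. *)
pose dn (P : {poly R}) := P \Po (- 2^-1 *: 'X + (2^-1)%:P).
pose up (P : {poly R}) := P \Po (2^-1 *: 'X + (2^-1)%:P).
have dnE P x : (dn P).[x] = P.[- 2^-1 * x + 2^-1].
  by rewrite /dn horner_comp !(hornerD, hornerZ, hornerX, hornerC).
have upE P x : (up P).[x] = P.[2^-1 * x + 2^-1].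
  by rewrite /up horner_comp !(hornerD, hornerZ, hornerX, hornerC).
have e1 : - 2^-1 * 1 + 2^-1 = 0 :> R by field.
have e2 : - 2^-1 * -1 + 2^-1 = 1 :> R by field.
have e3 : 2^-1 * -1 + 2^-1 = 0 :> R by field.
have e4 : 2^-1 * 1 + 2^-1 = 1 :> R by field.
have ds (P : {poly R}) : (size P <= (4 * n - 1).+2)%N -> (size (dn P) <= (4 * n - 1).+2)%N.
  by apply: leq_trans; exact: comp_affine_size.
have us (P : {poly R}) : (size P <= (4 * n - 1).+2)%N -> (size (up P) <= (4 * n - 1).+2)%N.
  by apply: leq_trans; exact: comp_affine_size.
have := @span_four R S (4 * n - 1) r (reflect_poly r) bubble_in_span hat_in_span sr sr' rl rr r'l r'r
  (dn (Ln i)) (up (Lp i)) (dn (Rn i)) (up (Rp i)) (-2) (ds _ sLn) (us _ sLp) (ds _ sRn) (us _ sRp).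
rewrite !dnE !upE e1 e2 e3 e4 => /(_ m1 m2 m3 m4 m5) /linear_span_ext; apply => x.
have -> : Phi4n i (x / 2) = tr (i, 0) (x / 2) by rewrite /translates subr0.
rewrite translatesE //.
have := piece_dilation (Rp i) (Rn i) 0 => /(congr1 (fun f => f x)) /= ->.
have := piece_dilation (Lp i) (Ln i) (0 - 1) => /(congr1 (fun f => f x)) /= ->.
have -> : 0 - 1 + (0 - 1) = -2 :> int by [].
have -> : 0 + 0 = -2 + 2 :> int by [].
have -> : -2 + 2 + 1 = -2 + 3 :> int by [].
by rewrite [RHS]addrC !addrA.
Qed.

End Refinement4n.

Theorem theorem14 (R : realType) (n : nat) (hn : (1 <= n)%N) :
  generates_orthogonal_MRA (@Phi4n R n).
Proof.
have sum_gt0 (F : 'I_(4 * n).+1 -> R) i : (forall j, 0 < F j) -> F i <= \sum_j F j.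
  by move=> F0; rewrite (bigD1 i) //= lerDl sumr_ge0 // => j _; exact: ltW.
pose N (i : 'I_(4 * n).+1) : R := sqnorm n i.
have N0 i : 0 < N i by exact: sqnorm_gt0.
have NV0 i : 0 < (N i)^-1 by rewrite invr_gt0.
have B0 : 0 < \sum_i N i := lt_le_trans (N0 ord0) (sum_gt0 N ord0 N0).
have A0 : 0 < \sum_i (N i)^-1 := lt_le_trans (NV0 ord0) (sum_gt0 (fun i => (N i)^-1) ord0 NV0).
(* The squared norm of a translate depends only on i. These finitely many positive numbers are
   bounded above by their sum and below by the inverse of the sum of their inverses. *)
have [|||riesz orth] := @orthogonal_riesz R _ (translates (@Phi4n R n))
  (\sum_i (N i)^-1)^-1 (\sum_i N i) _ B0 (L2_translates hn).
- by rewrite invr_gt0.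
- case=> i k; rewrite inner_translates // eqxx -/(sqnorm n i) -/(N i) sum_gt0 // andbT.
  by rewrite -[leRHS]invrK lef_pV2 ?posrE // (sum_gt0 (fun i => (N i)^-1)).
- exact: inner_translates_neq.
split => //; split => //.
  move=> i; split.
    have <- : translates (@Phi4n R n) (i, 0) = Phi4n i.
      by apply/funext => x; rewrite /translates subr0.
    exact: L2_translates.
  rewrite /compactly_supported; apply: (subclosed_compact _ (@segment_compact R (-1) 1)).
    exact: closed_closure.
  rewrite closureE; apply: smallest_sub; first exact: interval_closed.
  move=> x /=; rewrite in_itv /=; apply: contra_neqT; rewrite negb_and -!ltNge => xN.
  have h1 : (-1 <= x < 0) = false by apply/negP => /andP[? ?]; case/orP: xN => ?; lra.
  have h2 : (0 <= x < 1) = false by apply/negP => /andP[? ?]; case/orP: xN => ?; lra.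
  by rewrite /Phi4n /phi_tilde h1 h2; case: (i : nat) => [|[|]].
exact: refinable_nested (L2_translates hn) (Phi4n_refinable hn).
Qed.
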